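(* Suppose that an equation $\mathcal L$: $L=0$ (with $L$ a differential function of order $r>1$ in two independent variables $x=(x_1,x_2)$ and one dependent variable $u$) possesses a co-order one singular set $S=\{Q^\zeta\}$ of vector fields in reduced form $Q^\zeta=\xi\partial_1+\partial_2+\zeta\partial_u$, where $\xi=\xi(x,u)$ is fixed and $\zeta$ runs through all smooth functions of $(x,u)$. Then for any one-parametric family $\mathcal F$ of solutions of $\mathcal L$ there exists a value of the parameter-function $\zeta=\zeta(x,u)$ such that $Q^\zeta$ is a reduction operator of $\mathcal L$ and each solution from $\mathcal F$ is invariant with respect to $Q^\zeta$.
   Context: All considerations are local; functions are smooth. Subscripts $1,2,u$ denote partial derivatives; $\partial_i=\partial/\partial x_i$. $J^r$ is the jet space with coordinates $x$ and $u_\alpha$, $\alpha=(\alpha_1,\alpha_2)$, $|\alpha|\le r$; $D_1,D_2$ are the total derivatives. A differential function of order $r$ is a smooth function on (a subset of) $J^r$ involving derivatives of maximal order $r$; the zero function has order $-1$. For a vector field $Q=\xi^1\partial_1+\xi^2\partial_2+\eta\partial_u$ (coefficients functions of $(x,u)$, $(\xi^1,\xi^2)\ne(0,0)$) put $Q[u]=\eta-\xi^1u_1-\xi^2u_2$ and $\mathcal Q_{(r)}=\{D_1^{a}D_2^{b}Q[u]=0,\ a+b<r\}\subset J^r$. A function $u=f(x)$ is $Q$-invariant if it solves $Q[u]=0$. Singularity co-order of $Q$ for $L$ (order $r$): the minimal order $k$ of differential functions $\tilde L$ with $L|_{\mathcal Q_{(r)}}=\tilde L|_{\mathcal Q_{(r)}}$.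 $Q$ is singular for $L$ if $k<r$, and ultra-singular if $L|_{\mathcal Q_{(r)}}\equiv0$ (co-order $-1$). A set of vector fields is co-order one singular for $L$ if all its elements are singular for $L$ and the maximum of their singularity co-orders is $1$. $Q$ is a reduction operator of $\mathcal L$ if the $r$th prolongation of $Q$ applied to $L$ vanishes on $\{L=0\}\cap\mathcal Q_{(r)}$. A one-parametric family of solutions is a family $u=f(x,\varkappa)$ of solutions with the parameter $\varkappa$ essential, i.e. $f_\varkappa\neq0$. For $S$ as in the claim, eliminating derivatives that involve $x_2$-differentiation on $\mathcal Q^\zeta_{(r)}$ gives a differential function $\tilde L^\zeta$ depending only on $x,u,u_1$ with $L|_{\mathcal Q^\zeta_{(r)}}=\tilde L^\zeta|_{\mathcal Q^\zeta_{(r)}}$. Standing assumption: $\tilde L^\zeta$ is of maximal rank with respect to $u$ (resp. $u_1$) if the singularity co-order of $Q^\zeta$ is $0$ (resp. $1$), i.e. $\tilde L^\zeta_u\neq0$ (resp. $\tilde L^\zeta_{u_1}\ne0$) on $\tilde L^\zeta=0$. Without loss of generality (up to point transformations) the paper takes $\xi\in\{0,u\}$. *)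

(* Defs.v *)
From HB Require Import structures.
From mathcomp Require Import all_boot all_order all_algebra.
From mathcomp Require Import all_classical all_reals all_analysis.

Set Implicit Arguments.
Unset Strict Implicit.
Unset Printing Implicit Defensive.

Import Order.TTheory GRing.Theory Num.Theory.
Import numFieldNormedType.Exports.

Local Open Scope classical_set_scope.
Local Open Scope ring_scope.

(* Meant for an open set U of a finite-dimensional V, where it is the usual
   C^n: the values of f outside U are irrelevant. *)
Fixpoint Cn_on (R : realType) (V : normedModType R) (n : nat)
    (U : set V) (f : V -> R) : Prop :=
  match n with
  | 0%N => forall x, U x -> {for x, continuous f}
  | m.+1 => (forall x, U x -> differentiable f x) /\
            (forall v : V, Cn_on m U ('D_v f))
  end.

Definition smooth_on (R : realType) (V : normedModType R)
    (U : set V) (f : V -> R) : Prop := forall n, Cn_on n U f.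

Definition midx (r : nat) : finType :=
  {a : 'I_r.+1 * 'I_r.+1 | (a.1 + a.2 <= r)%N}.

Definition m1 (r : nat) (a : midx r) : nat := (val a).1.
Definition m2 (r : nat) (a : midx r) : nat := (val a).2.

(* The points ((x_1, x_2), u_alpha (|alpha| <= r)) of J^r. *)
Definition jet (R : realType) (r : nat) : normedModType R :=
  ((R * R) * 'rV[R]_#|midx r|)%type.

(* The coordinate u_(a,b); it reads 0 when a + b > r. *)
Definition uc (R : realType) (r : nat) (p : jet R r) (a b : nat) : R :=
  if [pick c : midx r | (m1 c == a) && (m2 c == b)] is Some c
  then p.2 0 (enum_rank c) else 0.

Definition xu (R : realType) (r : nat) (p : jet R r) : R * R * R :=
  (p.1, uc p 0 0).

Definition xuu1 (R : realType) (r : nat) (p : jet R r) : R * R * R * R :=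
  (p.1, uc p 0 0, uc p 1 0).

(* For k <= r, the projection J^r -> J^k. *)
Definition jproj (R : realType) (r k : nat) (p : jet R r) : jet R k :=
  (p.1, \row_i uc p (m1 (enum_val i)) (m2 (enum_val i))).

Definition px1 (R : realType) (g : R * R -> R) : R * R -> R :=
  'D_((1, 0) : R * R) g.
Definition px2 (R : realType) (g : R * R -> R) : R * R -> R :=
  'D_((0, 1) : R * R) g.

Definition jet_of (R : realType) (r : nat) (g : R * R -> R) (x : R * R) :
    jet R r :=
  (x, \row_i iter (m1 (enum_val i)) (@px1 R)
               (iter (m2 (enum_val i)) (@px2 R) g) x).

Definition d_x1 (R : realType) (r : nat) (F : jet R r -> R) : jet R r -> R :=
  'D_(((1, 0), 0) : jet R r) F.
Definition d_x2 (R : realType) (r : nat) (F : jet R r -> R) : jet R r -> R :=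
  'D_(((0, 1), 0) : jet R r) F.
Definition d_u (R : realType) (r : nat) (c : midx r) (F : jet R r -> R) :
    jet R r -> R :=
  'D_((0, delta_mx 0 (enum_rank c)) : jet R r) F.

(* D_i F is computed on J^r, so the coordinates u_alpha with |alpha| = r + 1
   read 0 (see [uc]).  If F only involves derivatives of order < r this is the
   exact total derivative; if F has order r it is the total derivative
   evaluated where all derivatives of order r + 1 vanish. *)
Definition D1 (R : realType) (r : nat) (F : jet R r -> R) : jet R r -> R :=
  fun p => d_x1 F p + \sum_(c : midx r) uc p (m1 c).+1 (m2 c) * d_u c F p.
Definition D2 (R : realType) (r : nat) (F : jet R r -> R) : jet R r -> R :=
  fun p => d_x2 F p + \sum_(c : midx r) uc p (m1 c) (m2 c).+1 * d_u c F p.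

(* [order_le A F k]: on A, F coincides with a differential function of order
   at most k, i.e. with a smooth function on an open subset of J^k; order -1
   means the zero function. *)
Definition order_le (R : realType) (r : nat) (A : set (jet R r))
    (F : jet R r -> R) (k : int) : Prop :=
  match k with
  | Posz n => exists (W : set (jet R n)) (G : jet R n -> R),
      [/\ open W, smooth_on W G &
          forall p, A p -> W (jproj n p) /\ F p = G (jproj n p)]
  | Negz 0 => forall p, A p -> F p = 0
  | Negz _.+1 => False
  end.

Definition order_is (R : realType) (r : nat) (A : set (jet R r))
    (F : jet R r -> R) (k : int) : Prop :=
  order_le A F k /\ forall j : int, j < k -> ~ order_le A F j.

(* xi1 d/dx_1 + xi2 d/dx_2 + eta d/du on the subset [dom] of (x,u)-space. *)
Record vfield (R : realType) := VField {
  dom : set (R * R * R);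
  xi1 : R * R * R -> R;
  xi2 : R * R * R -> R;
  eta : R * R * R -> R }.

Definition charac (R : realType) (r : nat) (Q : vfield R) (p : jet R r) : R :=
  eta Q (xu p) - xi1 Q (xu p) * uc p 1 0 - xi2 Q (xu p) * uc p 0 1.

Definition Dcharac (R : realType) (r : nat) (Q : vfield R) (a b : nat) :
    jet R r -> R :=
  iter a (@D1 R r) (iter b (@D2 R r) (@charac R r Q)).

Definition Qman (R : realType) (r : nat) (Q : vfield R) : set (jet R r) :=
  [set p | dom Q (xu p) /\
           forall a b : nat, (a + b < r)%N -> Dcharac Q a b p = 0].

Definition invariant_at (R : realType) (Q : vfield R) (g : R * R -> R)
    (x : R * R) : Prop :=
  dom Q (x, g x) /\ charac Q (jet_of 1 g x) = 0.

(* eta^alpha = D^alpha Q[u] + xi1 u_(alpha+(1,0)) + xi2 u_(alpha+(0,1)).  For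
   |alpha| = r the derivatives of order r + 1 cancel in this expression, so
   reading them as 0 does not change its value. *)
Definition prol_coef (R : realType) (r : nat) (Q : vfield R) (c : midx r)
    (p : jet R r) : R :=
  Dcharac Q (m1 c) (m2 c) p
  + xi1 Q (xu p) * uc p (m1 c).+1 (m2 c)
  + xi2 Q (xu p) * uc p (m1 c) (m2 c).+1.

(* The r-th prolongation of Q applied to L; the term c = (0,0) is
   eta * dL/du. *)
Definition prolong (R : realType) (r : nat) (Q : vfield R)
    (L : jet R r -> R) (p : jet R r) : R :=
  xi1 Q (xu p) * d_x1 L p + xi2 Q (xu p) * d_x2 L p
  + \sum_(c : midx r) prol_coef Q c p * d_u c L p.

(* In the definitions below Om is the domain of L in J^r. *)
Definition reduction_operator (R : realType) (r : nat) (Om : set (jet R r))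
    (L : jet R r -> R) (Q : vfield R) : Prop :=
  forall p, Om p -> Qman Q p -> L p = 0 -> prolong Q L p = 0.

Definition coorder (R : realType) (r : nat) (Om : set (jet R r))
    (L : jet R r -> R) (Q : vfield R) (k : int) : Prop :=
  order_is (Om `&` Qman Q) L k.

Definition singular (R : realType) (r : nat) (Om : set (jet R r))
    (L : jet R r -> R) (Q : vfield R) : Prop :=
  exists k : int, coorder Om L Q k /\ k < r%:Z.

Definition coorder_one_singular (R : realType) (r : nat) (Om : set (jet R r))
    (L : jet R r -> R) (S : set (vfield R)) : Prop :=
  [/\ forall Q, S Q -> singular Om L Q,
      forall Q k, S Q -> coorder Om L Q k -> k <= 1 &
      exists2 Q, S Q & coorder Om L Q 1].

Definition Qzeta (R : realType) (xi : R * R * R -> R) (U : set (R * R * R))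
    (zeta : R * R * R -> R) : vfield R :=
  VField U xi (fun=> 1) zeta.

(* xi is defined on G; zeta runs through the smooth functions on the open
   subsets of G. *)
Definition reduced_set (R : realType) (G : set (R * R * R))
    (xi : R * R * R -> R) : set (vfield R) :=
  [set Q | exists (U : set (R * R * R)) (zeta : R * R * R -> R),
     [/\ open U, U `<=` G, smooth_on U zeta & Q = Qzeta xi U zeta]].

(* Lt is a function of (x,u,u_1) with L = Lt on Q_(r).  When xi2 = 1 the image
   of Om `&` Qman Q in (x,u,u_1)-space is open, so that Lt and its partial
   derivatives are uniquely determined on this image. *)
Definition eliminated (R : realType) (r : nat) (Om : set (jet R r))
    (L : jet R r -> R) (Q : vfield R)
    (W : set (R * R * R * R)) (Lt : R * R * R * R -> R) : Prop :=
  [/\ open W, smooth_on W Lt &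
      forall p, Om p -> Qman Q p -> W (xuu1 p) /\ L p = Lt (xuu1 p)].

Definition max_rank_along (R : realType) (r : nat) (Om : set (jet R r))
    (Q : vfield R) (Lt : R * R * R * R -> R) (v : R * R * R * R) : Prop :=
  forall p, Om p -> Qman Q p -> Lt (xuu1 p) = 0 -> 'D_v Lt (xuu1 p) != 0.

Definition max_rank (R : realType) (r : nat) (Om : set (jet R r))
    (L : jet R r -> R) (Q : vfield R) : Prop :=
  forall W Lt, eliminated Om L Q W Lt ->
    (coorder Om L Q 0 -> max_rank_along Om Q Lt (0, 0, 1, 0)) /\
    (coorder Om L Q 1 -> max_rank_along Om Q Lt (0, 0, 0, 1)).

(* u = f(x, kappa), for (x, kappa) in V, with f_kappa != 0. *)
Definition solution_family (R : realType) (r : nat) (Om : set (jet R r))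
    (L : jet R r -> R) (V : set (R * R * R)) (f : R * R * R -> R) : Prop :=
  [/\ open V, smooth_on V f,
      forall z, V z -> 'D_((0, 1) : R * R * R) f z != 0 &
      forall x kappa, V (x, kappa) ->
        Om (jet_of r (fun y => f (y, kappa)) x) /\
        L (jet_of r (fun y => f (y, kappa)) x) = 0].

(* Main.v *)
Require Import Defs.
From HB Require Import structures.
From mathcomp Require Import all_boot all_order all_algebra.
From mathcomp Require Import all_classical all_reals all_analysis.
From mathcomp Require Import zify ring lra.

Set Implicit Arguments.
Unset Strict Implicit.
Unset Printing Implicit Defensive.

Import Order.TTheory GRing.Theory Num.Theory.
Import numFieldNormedType.Exports.

Local Open Scope classical_set_scope.
Local Open Scope ring_scope.

(** Solving u = f(x, k) for k = Phi(x, u), put zeta = f_2 + xi f_1 at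
   (x, Phi(x, u)), so that all members of the family are Q-invariant and their
   jets lie on the manifold Q_(r).  The prolonged field v is tangent to Q_(r),
   hence at a point p of Q_(r) the prolongation of Q applied to L is the
   derivative of the eliminated function Lt(x, u, u_1) along the image of v.
   If the co-order is -1, then Lt = 0.  Co-order 0 is impossible: differentiating
   Lt(x, f) = 0 in the parameter gives Lt_u f_k = 0.  If it is 1, then
   Lt_(u_1) <> 0 makes u_1 a function of (x, u) on Lt = 0 near the family; this
   function is f_1(x, Phi(x, u)), and differentiating Lt(x, f, f_1) = 0 along
   (xi, 1) shows that the derivative of Lt along v vanishes. *)

(** * Differential calculus *)

(** The obstacle is that the prolongation involves derivatives of L transversal to Q_(r), while Lt
    describes L on Q_(r) alone. Tangency of v is turned into an equality of derivatives without
    parametrizing Q_(r): repeated substitution of the x_2-derivatives gives a map T that sends a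
    neighbourhood of p into Q_(r), fixes p and, by tangency, satisfies dT(v) = v. Hence v(L) = v(L o
    T), and L o T can be expressed through Lt.

    Tangency itself is an algebraic identity once D_1^a D_2^b Q[u] is written as h_(a,b) - xi
    u_(a+1,b) - u_(a,b+1), where h_(a,b) is the prolongation coefficient; the same h then gives both
    the components of v and the equations of Q_(r).

    The statement is local for two reasons. Phi exists only near a member of the family, and Lt(x,
    u, .) may have further zeros, about which the family says nothing. So the domain of L is cut
    down to jets where Lt is strictly monotone in u_1; the root over (x, u) is then unique and must
    be the value f_1 of the family. *)

Section Differentiability.
Variable R : realType.
Implicit Types V W : normedModType R.

Lemma differentiable_of_bound V W (f : V -> W) (x : V) (df : {linear V -> W}) :
  continuous df ->
  (forall e : R, 0 < e ->
     \forall h \near 0, `|f (h + x) - f x - df h| <= e * `|h|) ->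
  differentiable f x /\ 'd f x = df :> (V -> W).
Proof.
move=> dfc fdf.
have E : f \o shift x = cst (f x) + df +o_ 0 id.
  apply/eqaddoP => e e0; have := fdf e e0.
  by apply: filterS => h; rewrite /= !fctE opprD addrA.
have D := diff_unique dfc E; split => //.
by apply/diff_locallyP; rewrite D.
Qed.

Lemma near_eq_differentiable V W (f g : V -> W) (x : V) :
  {near x, f =1 g} -> differentiable f x -> differentiable g x.
Proof.
move=> fg df; suff [] : differentiable g x /\ 'd g x = 'd f x :> (V -> W) by [].
apply: differentiable_of_bound; first exact: diff_continuous.
move=> e e0; have /diff_locally/eqaddoP/(_ e e0) := df.
rewrite -(nbhs_singleton fg).
have : \forall h \near 0, f (h + x) = g (h + x).
  have := fg; rewrite (near_shift 0 x); apply: filterS => h /=.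
  by rewrite subr0.
by apply: filterS2 => h /= fgh; rewrite !fctE /= fgh opprD addrA.
Qed.

(** Maps into three-space and into jet space are brought to this form, scalar functions times fixed
    vectors, so that one chain rule in terms of partial derivatives serves for both. *)
Lemma differentiable_lincomb V W (I : Type) (s : seq I) (g : I -> V -> R)
    (e : I -> W) (x : V) :
  (forall i, differentiable (g i) x) ->
  differentiable (fun y => \sum_(i <- s) g i y *: e i) x /\
  forall v, 'd (fun y => \sum_(i <- s) g i y *: e i) x v =
    \sum_(i <- s) 'd (g i) x v *: e i.
Proof.
move=> dg; elim: s => [|i s [IHd IHv]].
  have -> : (fun y => \sum_(i <- [::]) g i y *: e i) = cst 0.
    by apply/funext => y; rewrite big_nil.
  split=> [|v]; first exact: differentiable_cst.
  by rewrite diff_cst big_nil.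
have -> : (fun y => \sum_(j <- i :: s) g j y *: e j) =
    (fun y => g i y *: e i) + (fun y => \sum_(j <- s) g j y *: e j).
  by apply/funext => y; rewrite big_cons.
have di : differentiable (fun y => g i y *: e i) x.
  exact: differentiableZl.
split=> [|v]; first exact: differentiableD.
have eD : 'd ((fun y => g i y *: e i) + (fun y => \sum_(j <- s) g j y *: e j)) x v
    = 'd (fun y => g i y *: e i) x v +
      'd (fun y => \sum_(j <- s) g j y *: e j) x v.
  exact: (congr1 (@^~ v) (diffD di IHd)).
have eZ : 'd (fun y => g i y *: e i) x v = 'd (g i) x v *: e i.
  exact: (congr1 (@^~ v) (diffZl (e i) (dg i))).
by rewrite eD eZ IHv big_cons.
Qed.

Lemma derive_comp_lincomb V W (I : Type) (s : seq I) (g : I -> V -> R)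
    (e : I -> W) (F : W -> R) (x v : V) :
  (forall i, differentiable (g i) x) ->
  differentiable F (\sum_(i <- s) g i x *: e i) ->
  'D_v (fun y => F (\sum_(i <- s) g i y *: e i)) x =
  \sum_(i <- s) 'D_v (g i) x * 'D_(e i) F (\sum_(i <- s) g i x *: e i).
Proof.
move=> dg dF; have [dG dGv] := differentiable_lincomb s e dg.
rewrite deriveE; last exact: (differentiable_comp dG dF).
rewrite (diff_comp dG dF) /= dGv linear_sum; apply: eq_bigr => i _.
by rewrite linearZ /= !deriveE.
Qed.

Lemma derive_fun_linear V (f : V -> R) (z : V) :
  (forall (k : R) v w, f (k *: v + w) = k * f v + f w) -> continuous f ->
  differentiable f z /\ forall v, 'D_v f z = f v.
Proof.
move=> flin fc; have fl : linear f by move=> k v w; rewrite flin.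
pose F : {linear V -> R} := HB.pack f (GRing.isLinear.Build _ _ _ _ _ fl).
have dF : differentiable f z by exact: (linear_differentiable (f := F)).
split=> // v; rewrite deriveE//.
exact: (congr1 (@^~ v) (diff_lin (f := F) z fc)).
Qed.

Lemma derive_eq0 V (F : V -> R) (v p : V) :
  (forall h, F (h *: v + p) = F p) -> 'D_v F p = 0.
Proof.
move=> Fh; rewrite /derive.
have -> : (fun h : R => h^-1 *: ((F \o shift p) (h *: v) - F p)) = cst 0.
  by apply/funext => h /=; rewrite Fh subrr scaler0.
exact: lim_cst.
Qed.

End Differentiability.

(** * Closure properties of C^n functions *)

Section Cn.
Variable R : realType.
Implicit Types (V W : normedModType R) (n : nat).

Lemma near_open V (U : set V) (P : V -> Prop) (x : V) :
  open U -> U x -> (forall y, U y -> P y) -> \forall y \near x, P y.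
Proof.
move=> Uo Ux UP; have : nbhs x U by apply: open_nbhs_nbhs.
by apply: filterS.
Qed.

Lemma Cn_on_ext V n (U : set V) (f g : V -> R) :
  open U -> (forall x, U x -> f x = g x) -> Cn_on n U f -> Cn_on n U g.
Proof.
move=> Uo; elim: n f g => [|n IH] f g fg /=.
  move=> fc x Ux; change (g y @[y --> x] --> g x); rewrite -(fg x Ux).
  apply: cvg_trans (fc x Ux); apply: near_eq_cvg.
  exact: near_open Uo Ux fg.
move=> [df Dv]; split=> [x Ux|v].
  by apply: near_eq_differentiable (df x Ux); apply: near_open Uo Ux fg.
apply: IH (Dv v) => x Ux; apply: near_eq_derive.
exact: near_open Uo Ux fg.
Qed.

Lemma Cn_on_subset V n (U U' : set V) (f : V -> R) :
  U' `<=` U -> Cn_on n U f -> Cn_on n U' f.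
Proof.
move=> sU; elim: n f => [|n IH] f /=; first by move=> fc x /sU/fc.
by move=> [df Dv]; split=> [x /sU/df//|v]; apply: IH.
Qed.

Lemma Cn_on_pred V n (U : set V) (f : V -> R) :
  Cn_on n.+1 U f -> Cn_on n U f.
Proof.
elim: n f => [|n IH] f /=.
  by move=> [df _] x /df; apply: differentiable_continuous.
by move=> [df Dv]; split=> // v; apply: IH; apply: Dv.
Qed.

Lemma Cn_on_cst V n (U : set V) (c : R) : Cn_on n U (fun=> c : R).
Proof.
elim: n c => [|n IH] c /=; first by move=> x _; apply: cst_continuous.
split=> [x _|v]; first exact: differentiable_cst.
have -> : 'D_v (fun=> c) = (fun=> 0) :> (V -> R).
  by apply/funext => y; apply: derive_cst.
exact: IH.
Qed.

Lemma Cn_onD V n (U : set V) (f g : V -> R) : open U ->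
  Cn_on n U f -> Cn_on n U g -> Cn_on n U (fun x => f x + g x).
Proof.
move=> Uo; elim: n f g => [|n IH] f g /=.
  by move=> fc gc x Ux; apply: cvgD; [exact: fc|exact: gc].
move=> [df Dvf] [dg Dvg]; split=> [x Ux|v].
  by apply: differentiableD; [exact: df|exact: dg].
apply: Cn_on_ext (IH _ _ (Dvf v) (Dvg v)) => // x Ux.
by rewrite deriveD//; apply: diff_derivable; [exact: df|exact: dg].
Qed.

Lemma Cn_onM V n (U : set V) (f g : V -> R) : open U ->
  Cn_on n U f -> Cn_on n U g -> Cn_on n U (fun x => f x * g x).
Proof.
move=> Uo; elim: n f g => [|n IH] f g.
  by move=> fc gc x Ux; apply: cvgM; [exact: fc|exact: gc].
move=> Cf Cg; have [df Dvf] := Cf; have [dg Dvg] := Cg.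
split=> [x Ux|v]; first by apply: differentiableM; [exact: df|exact: dg].
have := Cn_onD Uo (IH _ _ (Cn_on_pred Cf) (Dvg v))
  (IH _ _ (Cn_on_pred Cg) (Dvf v)).
apply: Cn_on_ext => // x Ux.
by rewrite deriveM//; apply: diff_derivable; [exact: df|exact: dg].
Qed.

Lemma Cn_on_sum V n (U : set V) (I : Type) (s : seq I) (f : I -> V -> R) :
  open U -> (forall i, Cn_on n U (f i)) ->
  Cn_on n U (fun x => \sum_(i <- s) f i x).
Proof.
move=> Uo Cf; elim: s => [|i s IH].
  apply: Cn_on_ext (Cn_on_cst n U 0) => // x _; by rewrite big_nil.
by apply: Cn_on_ext (Cn_onD Uo (Cf i) IH) => // x _; rewrite big_cons.
Qed.

Lemma Cn_on_inv V n (U : set V) (f : V -> R) : open U ->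
  (forall x, U x -> f x != 0) -> Cn_on n U f ->
  Cn_on n U (fun x => (f x)^-1).
Proof.
move=> Uo f0; elim: n => [|n IH].
  by move=> fc x Ux; apply: cvgV; [exact: f0|exact: fc].
move=> Cf; have [df Dvf] := Cf.
split=> [x Ux|v]; first by apply: differentiableV; [exact: df|exact: f0].
have Ci := IH (Cn_on_pred Cf).
have := Cn_onM Uo (Cn_on_cst n U (-1))
  (Cn_onM Uo (Cn_onM Uo Ci Ci) (Dvf v)).
apply: Cn_on_ext => // x Ux.
rewrite deriveV ?f0//; last by apply: diff_derivable; exact: df.
by rewrite -exprVn expr2 mulN1r scaleNr.
Qed.

Lemma Cn_onB V n (W : set V) (f g : V -> R) : open W ->
  Cn_on n W f -> Cn_on n W g -> Cn_on n W (fun x => f x - g x).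
Proof.
move=> Wo Cf Cg.
apply: Cn_on_ext (Cn_onD Wo Cf (Cn_onM Wo (Cn_on_cst n W (-1)) Cg)) => // x _.
by rewrite mulN1r.
Qed.

Lemma smooth_derive V (W : set V) (F : V -> R) (v : V) :
  smooth_on W F -> smooth_on W ('D_v F).
Proof. by move=> Fs n; exact: (Fs n.+1).2. Qed.

Lemma Cn_on_fun_linear V n (U : set V) (f : V -> R) :
  (forall (k : R) v w, f (k *: v + w) = k * f v + f w) -> continuous f ->
  Cn_on n U f.
Proof.
move=> flin fc; case: n => [|n] /=; first by move=> x _; exact: fc.
split=> [x _|v]; first exact: (derive_fun_linear x flin fc).1.
have -> : 'D_v f = (fun=> f v).
  by apply/funext => x; exact: (derive_fun_linear x flin fc).2.
exact: Cn_on_cst.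
Qed.

(** Induction on n, with F general: the chain rule writes the derivative as a sum of products of
    ['D_v (g i)] with composites of ['D_(e i) F], and the induction hypothesis applies to the
    latter. *)
Lemma Cn_on_comp V W n (U : set V) (U' : set W) (I : Type) (s : seq I)
    (F : W -> R) (g : I -> V -> R) (e : I -> W) :
  open U -> open U' -> (forall x, U x -> U' (\sum_(i <- s) g i x *: e i)) ->
  (forall i, Cn_on n U (g i)) -> Cn_on n U' F ->
  Cn_on n U (fun x => F (\sum_(i <- s) g i x *: e i)).
Proof.
move=> Uo U'o UU'; elim: n F g UU' => [|n IH] F g UU' Cg CF.
  move=> x Ux /=.
  have Gc : {for x, continuous (fun y => \sum_(i <- s) g i y *: e i)}.
    elim: s {UU'} => [|i s IHs].
      have -> : (fun y => \sum_(i <- [::]) g i y *: e i) = cst 0.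
        by apply/funext => y; rewrite big_nil.
      exact: cst_continuous.
    have -> : (fun y => \sum_(j <- i :: s) g j y *: e j) =
      (fun y => g i y *: e i + (\sum_(j <- s) g j y *: e j)).
      by apply/funext => y; rewrite big_cons.
    apply: cvgD; last exact: IHs.
    apply: cvgZr_tmp; exact: Cg.
  exact: (continuous_comp Gc (CF _ (UU' x Ux))).
have dg i x : U x -> differentiable (g i) x by move=> Ux; apply: (Cg i).1.
split=> [x Ux|v].
  apply: (differentiable_comp (f := fun x => \sum_(i <- s) g i x *: e i)).
    by have [] := differentiable_lincomb s e (fun i => dg i x Ux).
  exact/CF.1/UU'.
have C1 i : Cn_on n U
   (fun x => 'D_v (g i) x * 'D_(e i) F (\sum_(i <- s) g i x *: e i)).
  apply: Cn_onM => //; first exact: (Cg i).2.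
  by apply: (IH ('D_(e i) F) g UU') => [j|]; [exact: Cn_on_pred|exact: CF.2].
apply: Cn_on_ext (Cn_on_sum s Uo C1) => // x Ux.
rewrite derive_comp_lincomb// => [i|]; first exact: dg.
exact/CF.1/UU'.
Qed.

End Cn.

(** * Mean values and the symmetry of second derivatives *)

Section MeanValue.
Variable R : realType.
Implicit Types (V W : normedModType R).

Lemma MVT_itvcc (phi dphi : R -> R) (a b : R) : a < b ->
  (forall s, a <= s <= b -> is_derive s 1 phi (dphi s)) ->
  exists c, a < c < b /\ phi b - phi a = dphi c * (b - a).
Proof.
move=> ab dphiE.
have [||c cab E] := @MVT _ phi dphi a b ab.
- by move=> s; rewrite in_itv /= => /andP[/ltW as_ /ltW sb]; apply: dphiE; rewrite as_.
- apply: derivable_within_continuous => s; rewrite in_itv /= => /dphiE ds.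
  exact: (@ex_derive _ _ _ _ _ _ _ ds).
- by exists c; move: cab; rewrite in_itv.
Qed.

Lemma is_derive_line V W (f : V -> W) (x v : V) (s : R) :
  differentiable f (x + s *: v) ->
  is_derive s 1 (fun t => f (x + t *: v)) ('d f (x + s *: v) v).
Proof.
move=> df.
have lin : is_diff s (fun t : R => x + t *: v) (fun t => t *: v).
  have E : (0 : R -> V) + *:%R^~ v = *:%R^~ v by apply/funext => t; rewrite !fctE add0r.
  rewrite -[X in is_diff_def _ _ X]E.
  by apply: (is_diffD (f := cst x) (g := fun t : R => t *: v)).
have dl := @ex_diff _ _ _ _ _ _ _ lin.
apply: DeriveDef; first exact/diff_derivable/(differentiable_comp dl df).
rewrite deriveE; last exact: (differentiable_comp dl df).
by rewrite (diff_comp dl df) /= (@diff_val _ _ _ _ _ _ _ lin) scale1r.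
Qed.

Lemma is_derive_line_R V (f : V -> R) (x v : V) (s : R) :
  differentiable f (x + s *: v) ->
  is_derive s 1 (fun t => f (x + t *: v)) ('D_v f (x + s *: v)).
Proof. by move=> df; rewrite deriveE//; exact: is_derive_line. Qed.

(** The mean value theorem is applied first in direction v to the difference [phi], then in
    direction w. The left side of the equation is symmetric in v and w, which is the source of the
    symmetry of second derivatives. *)
Lemma second_difference V (f : V -> R) (U : set V) (x v w : V) (h : R) :
  0 < h -> Cn_on 2 U f ->
  (forall s t, 0 <= s <= h -> 0 <= t <= h -> U (x + s *: v + t *: w)) ->
  exists s t, [/\ 0 <= s <= h, 0 <= t <= h &
    f (x + h *: v + h *: w) - f (x + h *: v) - (f (x + h *: w) - f x) =
    'D_w ('D_v f) (x + s *: v + t *: w) * h * h].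
Proof.
move=> h0 [df Df] hU.
have h00 : 0 <= h <= h by rewrite ltW /=.
have z00 : 0 <= (0 : R) <= h by rewrite lexx ltW.
pose phi s := f (x + s *: v + h *: w) - f (x + s *: v).
pose dphi s := 'D_v f (x + s *: v + h *: w) - 'D_v f (x + s *: v).
have [s sh|s [/andP[s0 sh]]] := @MVT_itvcc phi dphi 0 h h0.
  have Es : phi = (fun t => f ((x + h *: w) + t *: v)) -
                  (fun t => f (x + t *: v)).
    by apply/funext => t; rewrite /phi !fctE addrAC.
  rewrite Es /dphi addrAC; apply: is_deriveB; apply: is_derive_line_R.
    by apply: df; rewrite addrAC; apply: hU.
  by apply: df; have := hU _ 0 sh z00; rewrite scale0r addr0.
rewrite /phi /dphi scale0r addr0 subr0 => ->.
have sh' : 0 <= s <= h by rewrite !ltW.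
have [t th|t [/andP[t0 th]]] := @MVT_itvcc
  (fun t => 'D_v f (x + s *: v + t *: w))
  (fun t => 'D_w ('D_v f) (x + s *: v + t *: w)) 0 h h0.
  by apply: is_derive_line_R; apply: (Df v).1; apply: hU.
rewrite scale0r addr0 subr0 => ->.
by exists s, t; split => //; rewrite !ltW.
Qed.

Lemma derive_comm V (f : V -> R) (U : set V) (x v w : V) :
  open U -> U x -> Cn_on 2 U f -> 'D_v ('D_w f) x = 'D_w ('D_v f) x.
Proof.
move=> Uo Ux Cf; have [_ Df] := Cf.
apply/eqP; rewrite -subr_eq0 -normr_le0; apply/ler_addgt0Pl => e e0.
have e2 : 0 < e / 2 by rewrite divr_gt0.
have close_g (g : V -> R) : {for x, continuous g} ->
    \forall y \near x, U y /\ `|g x - g y| < e / 2.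
  move=> /cvgrPdist_lt/(_ _ e2) gc.
  have : \forall y \near x, U y by apply: open_nbhs_nbhs.
  by apply: filterS2 gc => y.
have : \forall y \near x, (U y /\ `|'D_v ('D_w f) x - 'D_v ('D_w f) y| < e / 2) /\
    (U y /\ `|'D_w ('D_v f) x - 'D_w ('D_v f) y| < e / 2).
  apply: filterI; apply: close_g; [exact: (Df w).2|exact: (Df v).2].
move=> Bd0. have [d /= d0 Bd] := (nbhs_ballP _ _).1 Bd0.
(* This size keeps the parallelogram spanned by h v and h w inside the ball of radius d; the summand
   1 covers v = w = 0. *)
pose h := d / 2 / (`|v| + `|w| + 1).
have k0 : 0 < `|v| + `|w| + 1 by rewrite ltr_pwDr ?addr_ge0.
have h0 : 0 < h by rewrite !divr_gt0.
have near_x v' w' s t : `|v'| + `|w'| = `|v| + `|w| ->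
    0 <= s <= h -> 0 <= t <= h -> ball x d (x + s *: v' + t *: w').
  move=> vw /andP[s0 sh] /andP[t0 th]; rewrite -ball_normE /= distrC.
  rewrite -(addrA x) addrAC subrr add0r.
  apply: le_lt_trans (ler_normD _ _) _; rewrite !normrZ !ger0_norm//.
  have : s * `|v'| + t * `|w'| <= h * (`|v| + `|w|).
    by rewrite -vw mulrDr lerD// ler_wpM2r.
  move/le_lt_trans; apply.
  have : h * (`|v| + `|w|) <= h * (`|v| + `|w| + 1).
    by rewrite ler_wpM2l ?ltW// ltrDl.
  move/le_lt_trans; apply.
  by rewrite divfK ?gt_eqF// ltr_pdivrMr// ltr_pMr// ltr1n.
have [s [t [hs ht E]]] := second_difference h0 Cf
  (fun s t hs ht => (Bd _ (near_x v w s t erefl hs ht)).1.1).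
have [s' [t' [hs' ht' E']]] := second_difference h0 Cf
  (fun s t hs ht => (Bd _ (near_x w v s t (addrC _ _) hs ht)).1.1).
(* Both mean values, multiplied by h^2, equal the same second difference. *)
have Dy : 'D_w ('D_v f) (x + s *: v + t *: w) =
          'D_v ('D_w f) (x + s' *: w + t' *: v).
  have hh : h != 0 by rewrite gt_eqF.
  move: E E'; rewrite (addrAC x (h *: w)).
  move: ('D_w _ _) ('D_v _ _) (f _) (f _) (f _) (f _) => A B a b c d' E E'.
  apply: (mulIf hh); apply: (mulIf hh); rewrite -E -E'.
  by ring.
have [_ [_ b1]] := Bd _ (near_x v w s t erefl hs ht).
have [[_ b2] _] := Bd _ (near_x w v s' t' (addrC _ _) hs' ht').
rewrite addr0; move: b1 b2; rewrite Dy.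
move: ('D_v ('D_w f) x) ('D_w ('D_v f) x) ('D_v ('D_w f) _) => A B y b1 b2.
rewrite (_ : A - B = (A - y) - (B - y)); last by ring.
apply: le_trans (ler_normB _ _) _.
by rewrite [leRHS](splitr e); apply: lerD; apply: ltW; [exact: b2|exact: b1].
Qed.

End MeanValue.

Section CoordinateComposition.
Variables (R : realType) (V : normedModType R).
Implicit Types (U : set V) (n : nat).

Lemma pairD (A B : zmodType) (a a' : A) (b b' : B) :
  (a, b) + (a', b') = (a + a', b + b').
Proof. by []. Qed.

Lemma pairZ (A B : lmodType R) (k : R) (a : A) (b : B) :
  k *: (a, b) = (k *: a, k *: b).
Proof. by []. Qed.

Definition basis3 (i : nat) : R * R * R :=
  match i with 0%N => (1, 0, 0) | 1%N => (0, 1, 0) | _ => (0, 0, 1) end.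

Lemma lincomb3 (c : nat -> R) :
  \sum_(i <- iota 0 3) c i *: basis3 i = (c 0, c 1, c 2)%N.
Proof.
rewrite /iota !big_cons big_nil addr0 /basis3 !pairZ !scaler0.
rewrite !pairD !addr0 !add0r.
by rewrite /GRing.scale /= !mulr1.
Qed.

Lemma Cn_on_comp3 n U (U' : set (R * R * R)) (F : R * R * R -> R)
    (g : nat -> V -> R) :
  open U -> open U' -> (forall x, U x -> U' (g 0%N x, g 1%N x, g 2%N x)) ->
  (forall i, Cn_on n U (g i)) -> Cn_on n U' F ->
  Cn_on n U (fun x => F (g 0%N x, g 1%N x, g 2%N x)).
Proof.
move=> Uo U'o UU' Cg CF.
have -> : (fun x => F (g 0%N x, g 1%N x, g 2%N x)) =
    (fun x => F (\sum_(i <- iota 0 3) g i x *: basis3 i)).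
  by apply/funext => x; rewrite (lincomb3 (g^~ x)).
apply: Cn_on_comp CF => // x Ux.
by rewrite (lincomb3 (g^~ x)); exact: UU'.
Qed.

End CoordinateComposition.

(** * Implicit functions *)

Section ImplicitFunction.
Variables (R : realType) (X : normedModType R).
Implicit Types (f : X * R -> R) (x : X) (k u c e : R).

Lemma pair_line x (t : R) : (x, 0) + t *: (0, 1) = (x, t).
Proof.
by rewrite pairZ pairD scaler0 addr0 add0r /GRing.scale /= mulr1.
Qed.

(** Taking for c the derivative at [z0] treats both signs at once, as f c then has derivative c^2 >
    0 there. The lemma serves twice: to invert the family in its parameter, and to isolate a root
    u_1 of Lt. *)
Lemma slice_increasing f (V : set (X * R)) (z0 : X * R) :
  open V -> V z0 -> (forall z, V z -> differentiable f z) ->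
  {for z0, continuous ('D_((0, 1) : X * R) f)} ->
  'D_((0, 1) : X * R) f z0 != 0 ->
  exists c e, [/\ 0 < e, ball z0 e `<=` V &
    forall x k k', ball z0.1 e x -> ball z0.2 e k -> ball z0.2 e k' -> k < k' ->
      f (x, k) * c < f (x, k') * c].
Proof.
move=> Vo Vz0 df fc; set c := 'D_ _ f z0 => c0; exists c.
have cc : 0 < c * c by rewrite -expr2 exprn_even_gt0.
have : \forall z \near z0, V z /\ 0 < 'D_((0, 1) : X * R) f z * c.
  apply: filterI; first exact: open_nbhs_nbhs.
  have : {for z0, continuous (fun z => 'D_((0, 1) : X * R) f z * c)}.
    by apply: cvgM; [exact: fc|exact: cvg_cst].
  by move=> /cvgrPdist_lt/(_ _ cc); apply: filterS => z;
    rewrite ltr_distlC subrr => /andP[].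
move=> nV; have [e /= e0 Be] := (nbhs_ballP _ _).1 nV.
exists e; split => // [z /Be[]//|x k k' xe ke ke' kk'].
have inb t : k <= t <= k' -> ball z0 e (x, t).
  move=> /andP[kt tk']; split => //=.
  move: ke ke'; rewrite -!ball_normE /= !ltr_distlC => /andP[? ?] /andP[? ?].
  by rewrite (lt_le_trans _ kt)// (le_lt_trans tk').
have [t ht|t [/andP[kt tk']]] := @MVT_itvcc R (fun t => f (x, t))
  (fun t => 'D_((0, 1) : X * R) f ((x, 0) + t *: (0, 1))) k k' kk'.
  have -> : (fun t => f (x, t)) = (fun t => f ((x, 0) + t *: (0, 1))).
    by apply/funext => s; rewrite pair_line.
  apply: is_derive_line_R; apply: df.
  rewrite pair_line.
  by have [] := Be _ (inb t ht).
rewrite pair_line => E.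
rewrite -subr_gt0 -mulrBl E mulrAC mulr_gt0 ?subr_gt0//.
by have [|] := Be _ (inb t _); rewrite // !ltW.
Qed.

Lemma continuous_slice f x (k : R) :
  {for (x, k), continuous f} -> {for k, continuous (fun t => f (x, t))}.
Proof.
move=> fc.
have pc : {for k, continuous (fun t : R => (x, t))}.
  exact: (cvg_pair (cvg_cst x) cvg_id).
exact: (continuous_comp pc fc).
Qed.

Lemma solve_slice f (V : set (X * R)) (z0 : X * R) c e :
  (forall z, V z -> {for z, continuous f}) -> 0 < e -> ball z0 e `<=` V ->
  (forall x k k', ball z0.1 e x -> ball z0.2 e k -> ball z0.2 e k' -> k < k' ->
      f (x, k) * c < f (x, k') * c) ->
  exists (U : set (X * R)) (Phi : X * R -> R), [/\ open U,
    forall z, U z -> ball z0 e (z.1, Phi z) /\ f (z.1, Phi z) = z.2,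
    forall x k, ball z0 e (x, k) -> U (x, f (x, k)) /\ Phi (x, f (x, k)) = k &
    forall z, U z -> {for z, continuous Phi}].
Proof.
move=> fc e0 BV mono.
(* The points over which the solution is trapped strictly between a and b. These sets are open, so
   they give at once the openness of the domain of [Phi] and, with a and b close together, its
   continuity. *)
pose N a b : set (X * R) := [set z | ball z0.1 e z.1 /\
  (f (z.1, a) * c < z.2 * c /\ z.2 * c < f (z.1, b) * c)].
pose J : set R := ball z0.2 e.
pose Phi (z : X * R) := xget z0.2 [set k | J k /\ f (z.1, k) = z.2].
have fcs x k : ball z0.1 e x -> J k -> {for (x, k), continuous f}.
  by move=> xe ke; apply/fc/BV.
have inj x k k' : ball z0.1 e x -> J k -> J k' -> f (x, k) = f (x, k') -> k = k'.
  move=> xe ke ke' E; have [kk'|kk'|//] := ltgtP k k'.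
    by have := mono x k k' xe ke ke' kk'; rewrite E ltxx.
  by have := mono x k' k xe ke' ke kk'; rewrite E ltxx.
have between k k1 k2 : J k1 -> J k2 -> k1 <= k <= k2 -> J k.
  rewrite /J -!ball_normE /= !ltr_distlC => /andP[a1 _] /andP[_ a2] /andP[b1 b2].
  by rewrite (lt_le_trans a1 b1) (le_lt_trans b2 a2).
have ltab x a b : ball z0.1 e x -> J a -> J b ->
    f (x, a) * c < f (x, b) * c -> a < b.
  move=> xe ja jb; have [//|ba|->] := ltgtP a b; last by rewrite ltxx.
  by move=> /lt_trans/(_ (mono x b a xe jb ja ba)); rewrite ltxx.
have PhiE x k : ball z0.1 e x -> J k -> Phi (x, f (x, k)) = k.
  move=> xe jk; rewrite /Phi.
  have ex : exists k', J k' /\ f ((x, f (x, k)).1, k') = (x, f (x, k)).2 by exists k.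
  by have [j1 E] := xgetPex z0.2 ex; apply: (inj x).
have solve a b z : J a -> J b -> N a b z ->
    [/\ a < Phi z, Phi z < b & f (z.1, Phi z) = z.2].
  case: z => x u ja jb [/= xe [lu ul]].
  have ab := ltab x a b xe ja jb (lt_trans lu ul).
  have [k kab E] : exists2 k, k \in `[a, b] & f (x, k) * c = u * c.
    apply: (IVT (ltW ab)).
      apply: continuous_in_subspaceT => k; rewrite inE /= in_itv /= => kab.
      apply: cvgM; last exact: cvg_cst.
      exact/continuous_slice/fcs/(between k a b).
    by rewrite ge_min le_max (ltW lu) (ltW ul) orbT.
  move: kab; rewrite in_itv /= => kab.
  have c0 : c != 0 by apply/eqP => c0; move: lu; rewrite c0 !mulr0 ltxx.
  move/(mulIf c0) : E => E; have jk := between _ _ _ ja jb kab.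
  rewrite -E PhiE//; case/andP: kab => ak kb; rewrite !lt_neqAle ak kb !andbT; split=> //.
    by apply/eqP => ka; move: lu; rewrite -E ka ltxx.
  by apply/eqP => ka; move: ul; rewrite -E ka ltxx.
have No a b : J a -> J b -> open (N a b).
  move=> ja jb; rewrite openE => -[x u] [/= xe [lu ul]].
  have cont k : J k -> {for (x, u), continuous (fun z : X * R => f (z.1, k) * c)}.
    move=> jk; apply: cvgM; last exact: cvg_cst.
    have pc : {for (x, u), continuous (fun z : X * R => (z.1, k))}.
      exact: (cvg_pair cvg_fst (cvg_cst k)).
    exact: (continuous_comp pc (fcs _ _ xe jk)).
  have cont2 : {for (x, u), continuous (fun z : X * R => z.2 * c)}.
    by apply: cvgM; [exact: cvg_snd|exact: cvg_cst].
  apply: filterI; last apply: filterI.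
  - have : nbhs x (ball z0.1 e) by apply: open_nbhs_nbhs; split => //; exact: ball_open.
    exact: cvg_fst.
  - apply: filterS (cvgr_gt _ (cvgB cont2 (cont _ ja)) 0 _) => [z /=|];
      by rewrite subr_gt0.
  - apply: filterS (cvgr_gt _ (cvgB (cont _ jb) cont2) 0 _) => [z /=|];
      by rewrite subr_gt0.
(* Going at most half of the way from k to either end of the interval [J], and at most d, leaves
   both a and b inside [J]. *)
have room x k d : ball z0.1 e x -> J k -> 0 < d -> exists a b,
    [/\ J a, J b, N a b (x, f (x, k)) & k - d <= a /\ b <= k + d].
  move=> xe jk d0; have := jk; rewrite /J -ball_normE /= ltr_distlC => /andP[k1 k2].
  exists (k - Num.min d ((k - (z0.2 - e)) / 2)), (k + Num.min d ((z0.2 + e - k) / 2)).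
  have p1 : 0 < Num.min d ((k - (z0.2 - e)) / 2).
    by rewrite lt_min d0 divr_gt0 ?subr_gt0.
  have p2 : 0 < Num.min d ((z0.2 + e - k) / 2).
    by rewrite lt_min d0 divr_gt0 ?subr_gt0.
  have q1 : Num.min d ((k - (z0.2 - e)) / 2) <= (k - (z0.2 - e)) / 2.
    by rewrite ge_min lexx orbT.
  have q2 : Num.min d ((z0.2 + e - k) / 2) <= (z0.2 + e - k) / 2.
    by rewrite ge_min lexx orbT.
  have r1 : Num.min d ((k - (z0.2 - e)) / 2) <= d by rewrite ge_min lexx.
  have r2 : Num.min d ((z0.2 + e - k) / 2) <= d by rewrite ge_min lexx.
  move: p1 p2 q1 q2 r1 r2 k1 k2; move: (Num.min _ _) (Num.min _ _) => m' m.
  move=> p1 p2 q1 q2 r1 r2 k1 k2.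
  have ja : J (k - m) by rewrite /J -ball_normE /= ltr_distlC; lra.
  have jb : J (k + m') by rewrite /J -ball_normE /= ltr_distlC; lra.
  split => //; last by lra.
  by split => //=; split; apply: mono => //; lra.
exists [set z | exists a b, [/\ J a, J b & N a b z]], Phi; split.
- rewrite openE => z [a [b [ja jb Nz]]].
  have : nbhs z (N a b) by apply: open_nbhs_nbhs; split => //; exact: No.
  by apply: filterS => y Ny; exists a, b.
- move=> z [a [b [ja jb Nz]]]; have [l1 l2 E] := solve a b z ja jb Nz.
  split=> //; split => /=; first exact: Nz.1.
  by apply: (between _ a b) => //; rewrite !ltW.
- move=> x k [/= xe jk]; split; last exact: PhiE.
  by have [a [b [ja jb Nz _]]] := room x k 1 xe jk ltr01; exists a, b.
- move=> z [a [b [ja jb Nz]]]; have [l1 l2 E] := solve a b z ja jb Nz.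
  have jP : J (Phi z) by apply: (between _ a b) => //; rewrite !ltW.
  apply/cvgrPdist_lt => d d0.
  have d2 : 0 < d / 2 by rewrite divr_gt0.
  have [a' [b' [ja' jb' Nz' [h1 h2]]]] := room _ _ _ Nz.1 jP d2.
  have : nbhs z (N a' b').
    apply: open_nbhs_nbhs; split; first exact: No.
    by move: Nz'; rewrite E; case: (z) .
  apply: filterS => y /(solve _ _ _ ja' jb')[m1 m2 _].
  by rewrite ltr_distlC; lra.
Qed.

End ImplicitFunction.

(** * The differential of an implicit function *)

Section ImplicitDerivative.
Variables (R : realType) (X : normedModType R).
Implicit Types (f Phi : X * R -> R).

Lemma differentiable_solution f Phi (U : set (X * R)) (z : X * R) :
  open U -> U z -> (forall y, U y -> f (y.1, Phi y) = y.2) ->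
  {for z, continuous Phi} -> differentiable f (z.1, Phi z) ->
  'D_((0, 1) : X * R) f (z.1, Phi z) != 0 ->
  differentiable Phi z /\ forall v, 'D_v Phi z =
    (v.2 - 'D_((v.1, 0) : X * R) f (z.1, Phi z)) /
    'D_((0, 1) : X * R) f (z.1, Phi z).
Proof.
move=> Uo Uz fPhi Phic df; rewrite deriveE//.
set D := 'd f (z.1, Phi z); set b := D (0, 1) => b0.
have Dc : continuous D by exact: diff_continuous.
(* The candidate differential, found by linearizing f(x, Phi(x, u)) = u. *)
pose A (v : X * R) := (v.2 - D (v.1, 0)) / b.
have Alin : linear A.
  move=> k v w; rewrite /A.
  have -> : ((k *: v + w).1, 0) = k *: (v.1, 0) + (w.1, 0) :> X * R.
    by rewrite pairZ pairD scaler0 addr0.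
  have -> : (k *: v + w).2 = k * v.2 + w.2 by [].
  have -> : D (k *: (v.1, 0) + (w.1, 0)) = k * D (v.1, 0) + D (w.1, 0).
    by rewrite linearP.
  rewrite /GRing.scale /=; ring.
have [AL ALE] : exists AL : {linear (X * R)%type -> R}, AL = A :> (X * R -> R).
  pose AL : {linear (X * R)%type -> R} :=
    HB.pack A (GRing.isLinear.Build _ _ _ _ _ Alin).
  by exists AL.
have Ac : continuous AL.
  rewrite ALE => v; apply: cvgM; last exact: cvg_cst.
  apply: cvgB; first exact: cvg_snd.
  have pc : {for v, continuous (fun z : X * R => (z.1, 0 : R))}.
    exact: (cvg_pair cvg_fst (cvg_cst 0)).
  exact: (continuous_comp pc (Dc _)).
have [C C0 AC] := linear_lipschitz Ac.
have [e e0|dPhi dE] := @differentiable_of_bound R (X * R)%type R Phi z AL Ac; last first.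
  split=> // v; rewrite !deriveE// -/D -/(A v) -ALE.
  by have /(congr1 (@^~ v)) := dE.
(* The increment [kap] of [Phi] is itself bounded only through the error |A w - kap|. The first
   bound lets half of |b| times this error be absorbed on the left; the second makes the remainder
   at most e |b| |w| / 2. *)
pose eta := Num.min (`|b| / 2) (e * `|b| / (2 * (1 + C))).
have nb : 0 < `|b| by rewrite normr_gt0.
have C1 : 0 < 1 + C by rewrite addr_gt0.
have eta0 : 0 < eta by rewrite lt_min !divr_gt0 ?mulr_gt0.
have etab : eta <= `|b| / 2 by rewrite ge_min lexx.
have etae : eta <= e * `|b| / (2 * (1 + C)) by rewrite ge_min lexx orbT.
pose m (w : X * R) : X * R := (w.1, Phi (w + z) - Phi z).
have mc : {for (0 : X * R), continuous m}.
  have sc : {for (0 : X * R), continuous (fun w : X * R => w + z)}.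
    by apply: cvgD; [exact: cvg_id|exact: cvg_cst].
  have Phic0 : {for 0 + z, continuous Phi} by rewrite add0r.
  have Phic1 : {for (0 : X * R), continuous (fun w : X * R => Phi (w + z) - Phi z)}.
    by apply: cvgB; [exact: (continuous_comp sc Phic0)|exact: cvg_cst].
  exact: (cvg_pair cvg_fst Phic1).
have m0 : m 0 = 0 by rewrite /m add0r subrr.
have nearf : \forall w \near (0 : X * R),
    `|f (m w + (z.1, Phi z)) - f (z.1, Phi z) - D (m w)| <= eta * `|m w|.
  have nh : \forall h \near (m 0 : X * R),
      `|f (h + (z.1, Phi z)) - f (z.1, Phi z) - D h| <= eta * `|h|.
    rewrite m0; have /diff_locally/eqaddoP/(_ eta eta0) := df.
    by apply: filterS => h; rewrite !fctE /= opprD addrA.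
  exact: (mc _ nh).
have nearU : \forall w \near (0 : X * R), U (w + z).
  have : \forall y \near z, U y by apply: open_nbhs_nbhs.
  by rewrite (near_shift 0 z); apply: filterS => w /=; rewrite subr0.
apply: filterS2 nearf nearU => w.
have -> : m w + (z.1, Phi z) = ((w + z).1, Phi (w + z)).
  by rewrite /m pairD subrK.
move=> fb Uw; move: fb; rewrite !fPhi//.
have -> : (w + z).2 - z.2 = w.2 by rewrite /= addrK.
set kap := Phi (w + z) - Phi z.
have -> : D (m w) = D (w.1, 0) + kap * b.
  rewrite /m -/kap /b.
  have -> : (w.1, kap) = (w.1, 0) + kap *: (0, 1) :> X * R by rewrite pair_line.
  by rewrite linearD linearZ.
(* Along the graph of [Phi] the function f grows by exactly [w.2], so the linearization error of f
   is b times the error to be estimated. *)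
have -> : w.2 - (D (w.1, 0) + kap * b) = (A w - kap) * b.
  by rewrite /A; field.
have mw : `|m w| <= `|w| + `|kap|.
  rewrite /m -/kap prod_normE ge_max lerDr normr_ge0 andbT.
  by rewrite (@le_trans _ _ `|w|)// ?lerDl// prod_normE le_max lexx.
rewrite normrM => fb.
have {}fb : `|A w - kap| * `|b| <= eta * (`|w| + `|kap|).
  by apply: le_trans fb _; rewrite ler_wpM2l// ltW.
rewrite -ALE in fb; rewrite distrC.
have kA : `|kap| <= C * `|w| + `|AL w - kap|.
  have := ler_normB (AL w) (AL w - kap); rewrite subKr => /le_trans; apply.
  by rewrite lerD2r; exact: AC.
move: (`|AL w - kap|) (`|kap|) (`|w|) (`|b|)
  (normr_ge0 w) (normr_ge0 (AL w - kap)) kA fb nb etab etae.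
move=> d k n B n0 d0 kA fb nb etab etae.
have h1 : eta * (n + k) <= eta * ((1 + C) * n + d).
  by apply: ler_wpM2l; [exact: ltW|lra].
have h2 : eta * d <= B / 2 * d by apply: ler_wpM2r.
have h3 : eta * (1 + C) <= e * B / 2.
  rewrite (_ : e * B / 2 = e * B / (2 * (1 + C)) * (1 + C)).
    by apply: ler_wpM2r => //; exact: ltW.
  by field; rewrite gt_eqF.
have h4 : eta * (1 + C) * n <= e * B / 2 * n by apply: ler_wpM2r.
have h4' : eta * ((1 + C) * n + d) = eta * (1 + C) * n + eta * d by ring.
have h6 : d * B <= e * n * B by lra.
by rewrite ler_pM2r in h6.
Qed.

End ImplicitDerivative.

Section Coordinates3.
Variable R : realType.

Definition coord3 (i : nat) (z : R * R * R) : R :=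
  match i with 0%N => z.1.1 | 1%N => z.1.2 | _ => z.2 end.

Lemma coord3_continuous i : continuous (coord3 i).
Proof.
move=> z; have c1 : {for z, continuous (fun z : R * R * R => z.1)} by exact: cvg_fst.
case: i => [|[|i]] /=; last exact: cvg_snd.
  by apply: (continuous_comp c1); exact: cvg_fst.
by apply: (continuous_comp c1); exact: cvg_snd.
Qed.

Lemma Cn_on_coord3 i n (U : set (R * R * R)) : Cn_on n U (coord3 i).
Proof.
apply: Cn_on_fun_linear; last exact: coord3_continuous.
by move=> k v w; case: i => [|[|i]].
Qed.

Lemma Cn_on_graph n (U U' : set (R * R * R)) (F Phi : R * R * R -> R) :
  open U -> open U' -> (forall z, U z -> U' (z.1, Phi z)) ->
  Cn_on n U Phi -> Cn_on n U' F -> Cn_on n U (fun z => F (z.1, Phi z)).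
Proof.
move=> Uo U'o UU' CP CF.
pose g i := match i with 0%N => coord3 0 | 1%N => coord3 1 | _ => Phi end.
have E (z : R * R * R) : (z.1, Phi z) = (g 0 z, g 1 z, g 2 z)%N.
  by rewrite /g /coord3 -surjective_pairing.
apply: Cn_on_ext (Cn_on_comp3 (g := g) Uo U'o _ _ CF) => //.
- by move=> z _; rewrite E.
- by move=> z /UU'; rewrite E.
- by case=> [|[|i]]; [exact: Cn_on_coord3|exact: Cn_on_coord3|exact: CP].
Qed.

(** The maps (x, k) -> (x, f(x, k)) and (x, u) -> (x, Phi(x, u)) are mutually inverse between [B]
    and [U]; both directions are used. Smoothness is a bootstrap: the derivative of [Phi] is a
    quotient of derivatives of f along the graph, so [Phi] of class C^n is of class C^(n+1). *)
Theorem implicit_function (f : R * R * R -> R) (V : set (R * R * R)) z0 :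
  open V -> smooth_on V f ->
  (forall z, V z -> 'D_((0, 1) : R * R * R) f z != 0) -> V z0 ->
  exists (B U : set (R * R * R)) (Phi : R * R * R -> R),
    [/\ [/\ open B, B `<=` V & B z0], [/\ open U & smooth_on U Phi],
    forall z, U z -> B (z.1, Phi z) /\ f (z.1, Phi z) = z.2 &
    forall x k, B (x, k) -> U (x, f (x, k)) /\ Phi (x, f (x, k)) = k].
Proof.
move=> Vo fs f0 Vz0; have df z : V z -> differentiable f z by exact: (fs 1%N).1.
have [c [e [e0 BV mono]]] := slice_increasing Vo Vz0 df
  ((fs 1%N).2 (0, 1) z0 Vz0) (f0 _ Vz0).
have [U [Phi [Uo UP PU Pc]]] := solve_slice
  (fun z Vz => differentiable_continuous (df z Vz)) e0 BV mono.
exists (ball z0 e), U, Phi; split => //.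
  by split => //; [exact: ball_open|exact: ballxx].
split=> // n.
have UV z : U z -> V (z.1, Phi z) by move=> /UP[/BV].
have D z (Uz : U z) := differentiable_solution Uo Uz (fun y Uy => (UP y Uy).2)
  (Pc z Uz) (df _ (UV z Uz)) (f0 _ (UV z Uz)).
elim: n => [//|n IH]; split=> [z Uz|v]; first by have [] := D z Uz.
have C1 w : Cn_on n U (fun z => 'D_w f (z.1, Phi z)).
  exact: (Cn_on_graph Uo Vo UV IH ((fs n.+1).2 w)).
have Ci := Cn_on_inv Uo (fun z Uz => f0 _ (UV z Uz)) (C1 (0, 1)).
have := Cn_onM Uo (Cn_onD Uo (Cn_on_cst n U v.2)
  (Cn_onM Uo (Cn_on_cst n U (-1)) (C1 (v.1, 0)))) Ci.
by apply: Cn_on_ext => // z Uz; rewrite (D z Uz).2 mulN1r.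
Qed.

End Coordinates3.

(** * Total derivatives on jet space *)

Section JetCoordinates.
Variables (R : realType) (r : nat).
Implicit Types (p q v : jet R r) (c d : midx r) (a b : nat) (i j : bool).

Lemma midx_inj c d : m1 c = m1 d -> m2 c = m2 d -> c = d.
Proof.
case: c d => [[c1 c2] hc] [[d1 d2] hd]; rewrite /m1 /m2 /= => E1 E2.
by apply: val_inj; congr (_, _); apply: val_inj.
Qed.

Lemma midx_exists a b : (a + b <= r)%N -> exists c, m1 c = a /\ m2 c = b.
Proof.
move=> hab.
have ha : (a < r.+1)%N by rewrite ltnS (leq_trans _ hab)// leq_addr.
have hb : (b < r.+1)%N by rewrite ltnS (leq_trans _ hab)// leq_addl.
by exists (exist (fun a : 'I_r.+1 * 'I_r.+1 => a.1 + a.2 <= r)%N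
  (Ordinal ha, Ordinal hb) hab).
Qed.

Lemma midx_le c : (m1 c + m2 c <= r)%N.
Proof. by case: c. Qed.

Lemma ucE p c : uc p (m1 c) (m2 c) = p.2 0 (enum_rank c).
Proof.
rewrite /uc; case: pickP => [d /andP[/eqP E1 /eqP E2]|/(_ c)].
  by rewrite (midx_inj E1 E2).
by rewrite !eqxx.
Qed.

Lemma uc_out p a b : (r < a + b)%N -> uc p a b = 0.
Proof.
move=> hab; rewrite /uc; case: pickP => [d /andP[/eqP E1 /eqP E2]|//].
by have := midx_le d; rewrite E1 E2 leqNgt hab.
Qed.

Lemma uc_linear a b (k : R) p q : uc (k *: p + q) a b = k * uc p a b + uc q a b.
Proof.
rewrite /uc; case: pickP => [d _|_]; last by rewrite mulr0 addr0.
by rewrite !mxE.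
Qed.

Lemma uc_continuous a b : continuous (fun p => uc p a b).
Proof.
rewrite /uc; case: pickP => [d _|_] p; last exact: cvg_cst.
have c2 : {for p, continuous (fun p : jet R r => p.2)} by exact: cvg_snd.
have c3 : {for p.2, continuous (fun u : 'rV[R]_#|midx r| => u 0 (enum_rank d))}.
  exact: coord_continuous.
exact: (continuous_comp c2 c3).
Qed.

Lemma jet_ext p q : p.1 = q.1 ->
  (forall c, uc p (m1 c) (m2 c) = uc q (m1 c) (m2 c)) -> p = q.
Proof.
case: p q => [x u] [y w] /= -> E; congr (_, _); apply/rowP => k.
by have := E (enum_val k); rewrite !ucE enum_valK.
Qed.

Definition jindex : finType := (bool + midx r)%type.

Definition jbasis (k : jindex) : jet R r :=
  match k with
  | inl false => ((1, 0), 0)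
  | inl true => ((0, 1), 0)
  | inr c => (0, delta_mx 0 (enum_rank c))
  end.

Definition jcoord (k : jindex) p : R :=
  match k with
  | inl false => p.1.1
  | inl true => p.1.2
  | inr c => uc p (m1 c) (m2 c)
  end.

Lemma jcoord_linear k (t : R) p q :
  jcoord k (t *: p + q) = t * jcoord k p + jcoord k q.
Proof. by case: k => [[]|c] //=; rewrite uc_linear. Qed.

Lemma jcoord_continuous k : continuous (jcoord k).
Proof.
case: k => [[]|c] /= p; last exact: uc_continuous.
  have c1 : {for p, continuous (fun p : jet R r => p.1)} by exact: cvg_fst.
  by apply: (continuous_comp c1); exact: cvg_snd.
have c1 : {for p, continuous (fun p : jet R r => p.1)} by exact: cvg_fst.
by apply: (continuous_comp c1); exact: cvg_fst.
Qed.

Lemma jcoord_ext p q : (forall k, jcoord k p = jcoord k q) -> p = q.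
Proof.
move=> E; apply: jet_ext => [|c]; last exact: (E (inr c)).
rewrite [p.1]surjective_pairing [q.1]surjective_pairing.
by rewrite (E (inl false) : p.1.1 = _) (E (inl true) : p.1.2 = _).
Qed.

Lemma jcoord_basis k l : jcoord k (jbasis l) = (k == l)%:R.
Proof.
case: k => [k|c]; case: l => [l|d].
- by case: k; case: l.
- by case: k.
- by rewrite [LHS]ucE; case: l => /=; rewrite mxE.
- rewrite [LHS]ucE /= mxE eqxx /=; congr (nat_of_bool _)%:R.
  by apply/eqP/eqP => [/enum_rank_inj ->|[->]].
Qed.

Lemma jcoord_sum (k : jindex) (I : Type) (s : seq I) (f : I -> R) (e : I -> jet R r) :
  jcoord k (\sum_(l <- s) f l *: e l) = \sum_(l <- s) f l * jcoord k (e l).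
Proof.
elim: s => [|l s IH]; last by rewrite !big_cons jcoord_linear IH.
rewrite !big_nil; have := jcoord_linear k 1 0 0.
rewrite scale1r addr0 mul1r => /esym/eqP.
by rewrite -subr_eq0 addrK => /eqP.
Qed.

Lemma jet_lincomb p : p = \sum_(k <- enum jindex) jcoord k p *: jbasis k.
Proof.
apply: jcoord_ext => k; rewrite jcoord_sum.
under eq_bigr do rewrite jcoord_basis.
rewrite big_enum /= (bigD1 k)//= eqxx mulr1 big1 ?addr0// => l lk.
by rewrite eq_sym (negbTE lk) mulr0.
Qed.

Lemma derive_jcoord (F : jet R r -> R) p v : differentiable F p ->
  'D_v F p = \sum_k jcoord k v * 'D_(jbasis k) F p.
Proof.
move=> dF; rewrite deriveE// {1}(jet_lincomb v) linear_sum big_enum /=.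
by apply: eq_bigr => k _; rewrite linearZ /= deriveE.
Qed.

End JetCoordinates.

Section TotalDerivatives.
Variables (R : realType) (r : nat).
Implicit Types (p q v : jet R r) (c d : midx r) (a b n : nat) (i j : bool).
Implicit Types (F G : jet R r -> R) (O : set (jet R r)).

(** The boolean [i] selects the direction, [false] for x_1 and [true] for x_2, so that the rules for
    both total derivatives are proved together. *)
Definition sh1 i a := if i then a else a.+1.
Definition sh2 i b := if i then b.+1 else b.

Definition TD i F : jet R r -> R := if i then D2 F else D1 F.

(** The components of D_i as a vector field on the truncated jet space. *)
Definition tdcoef i (k : jindex r) p : R :=
  match k with
  | inl j => (j == i)%:R
  | inr c => uc p (sh1 i (m1 c)) (sh2 i (m2 c))
  end.

Lemma TDE i F p : TD i F p = \sum_k tdcoef i k p * 'D_(jbasis R k) F p.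
Proof.
rewrite big_sumType big_bool /=.
by case: i; rewrite /= mul0r mul1r ?add0r ?addr0.
Qed.

Lemma TD_ext i O F G p : open O -> O p -> (forall q, O q -> F q = G q) ->
  TD i F p = TD i G p.
Proof.
move=> Oo Op FG; rewrite !TDE; apply: eq_bigr => k _; congr (_ * _).
by apply: near_eq_derive; exact: near_open Oo Op FG.
Qed.

Lemma TDD i F G p : differentiable F p -> differentiable G p ->
  TD i (fun q => F q + G q) p = TD i F p + TD i G p.
Proof.
move=> dF dG; rewrite !TDE -big_split; apply: eq_bigr => k _ /=.
by rewrite -mulrDr -deriveD//; exact: diff_derivable.
Qed.

Lemma TDM i F G p : differentiable F p -> differentiable G p ->
  TD i (fun q => F q * G q) p = TD i F p * G p + F p * TD i G p.
Proof.
move=> dF dG; rewrite !TDE mulr_suml mulr_sumr -big_split.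
apply: eq_bigr => k _ /=.
have -> : 'D_(jbasis R k) (fun q => F q * G q) p =
    F p * 'D_(jbasis R k) G p + G p * 'D_(jbasis R k) F p.
  by apply: deriveM; exact: diff_derivable.
by ring.
Qed.

Lemma TD_cst i (t : R) p : TD i (fun=> t) p = 0.
Proof.
by rewrite TDE big1// => k _; rewrite derive_cst mulr0.
Qed.

Lemma TDB i F G p : differentiable F p -> differentiable G p ->
  TD i (fun q => F q - G q) p = TD i F p - TD i G p.
Proof.
move=> dF dG.
rewrite (TD_ext i (G := fun q => F q + (-1) * G q) openT I) => [|q _]; last first.
  by rewrite mulN1r.
have dc : differentiable (fun=> -1 : R) p by exact: differentiable_cst.
by rewrite TDD ?TDM ?TD_cst ?mul0r ?add0r ?mulN1r//; exact: differentiableM.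
Qed.

Lemma TD_sum i O (I : Type) (s : seq I) (F : I -> jet R r -> R) p : open O -> O p ->
  (forall k, Cn_on 1 O (F k)) ->
  TD i (fun q => \sum_(k <- s) F k q) p = \sum_(k <- s) TD i (F k) p.
Proof.
move=> Oo Op CF; elim: s => [|k s IH].
  rewrite (TD_ext i (G := fun=> 0) openT) ?TD_cst ?big_nil// => q _.
  by rewrite big_nil.
rewrite big_cons -IH -TDD; last 2 first.
- exact: (CF k).1.
- by have [+ _] := Cn_on_sum s Oo CF; exact.
by apply: (TD_ext i openT) => // q _; rewrite big_cons.
Qed.

Lemma Cn_on_uc n O a b : Cn_on n O (fun p => uc p a b).
Proof.
by apply: Cn_on_fun_linear => [k v w|]; [exact: uc_linear|exact: uc_continuous].
Qed.

Lemma Cn_on_tdcoef n O i k : Cn_on n O (tdcoef i k).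
Proof. by case: k => [j|c]; [exact: Cn_on_cst|exact: Cn_on_uc]. Qed.

Lemma Cn_on_TD n O i F : open O -> Cn_on n.+1 O F -> Cn_on n O (TD i F).
Proof.
move=> Oo CF.
have C1 k : Cn_on n O (fun p => tdcoef i k p * 'D_(jbasis R k) F p).
  by apply: Cn_onM => //; [exact: Cn_on_tdcoef|exact: CF.2].
apply: Cn_on_ext (Cn_on_sum (enum (jindex r)) Oo C1) => // p _.
by rewrite TDE big_enum.
Qed.

Lemma derive_jcoordE k v p : 'D_v (jcoord k) p = jcoord k v.
Proof.
exact: (derive_fun_linear p (jcoord_linear k) (@jcoord_continuous R r k)).2.
Qed.

Lemma TD_jcoord i k p : TD i (jcoord k) p = tdcoef i k p.
Proof.
rewrite TDE; under eq_bigr do rewrite derive_jcoordE jcoord_basis.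
rewrite (bigD1 k)//= eqxx mulr1 big1 ?addr0// => l lk.
by rewrite eq_sym (negbTE lk) mulr0.
Qed.

(** It holds for all a and b: a coordinate beyond order r reads 0, and so does its shift. *)
Lemma TD_uc i a b p : TD i (fun q => uc q a b) p = uc p (sh1 i a) (sh2 i b).
Proof.
have [/midx_exists[c [<- <-]]|hab] := leqP (a + b) r.
  by rewrite -[LHS]/(TD i (jcoord (inr c)) p) TD_jcoord.
rewrite (TD_ext i (G := fun=> 0) openT) => [|//|q _]; last by rewrite uc_out.
rewrite TD_cst uc_out//; apply: leq_trans hab _.
by case: i; rewrite /sh1 /sh2 ?addnS ?addSn.
Qed.

(** Truncation does not destroy commutation. In the first-order part the coefficients are
    coordinates shifted in both directions, and shifts commute; the second-order part is symmetric
    by [derive_comm]. *)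
Lemma TD_comm i j O F p : open O -> O p -> Cn_on 2 O F ->
  TD i (TD j F) p = TD j (TD i F) p.
Proof.
move=> Oo Op CF.
have E i' j' : TD i' (TD j' F) p =
    \sum_(k <- enum (jindex r)) (TD i' (tdcoef j' k) p * 'D_(jbasis R k) F p) +
    \sum_(k <- enum (jindex r)) \sum_l
      tdcoef i' l p * tdcoef j' k p * 'D_(jbasis R l) ('D_(jbasis R k) F) p.
  have C1 k : Cn_on 1 O (fun p => tdcoef j' k p * 'D_(jbasis R k) F p).
    by apply: Cn_onM => //; [exact: Cn_on_tdcoef|exact: CF.2].
  rewrite (TD_ext i' (G := fun q => \sum_(k <- enum (jindex r))
    (tdcoef j' k q * 'D_(jbasis R k) F q)) Oo Op) => [|q _]; last first.
    by rewrite TDE big_enum.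
  rewrite (TD_sum _ _ Oo Op C1) -big_split; apply: eq_bigr => k _ /=.
  rewrite TDM; last 2 first.
  - exact: (Cn_on_tdcoef 1 O j' k).1.
  - exact: (CF.2 _).1.
  congr (_ + _); rewrite TDE mulr_sumr; apply: eq_bigr => l _.
  by rewrite mulrA [_ * tdcoef j' k p]mulrC.
rewrite !E; congr (_ + _).
  apply: eq_bigr => k _; congr (_ * _).
  case: k => [k|c]; first by rewrite !TD_cst.
  by rewrite !TD_uc; case: i; case: j.
rewrite !big_enum exchange_big /=.
apply: eq_bigr => k _; apply: eq_bigr => l _.
by rewrite [tdcoef j l p * _]mulrC (derive_comm _ _ Oo Op CF).
Qed.

End TotalDerivatives.

(** * Which jet coordinates a function involves *)

Section Dependence.
Variables (R : realType) (r : nat).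
Implicit Types (p q v : jet R r) (F : jet R r -> R) (K : nat -> nat -> Prop).

(** This is a condition on values on the whole jet space, free of smoothness; it passes to
    directional derivatives because the difference quotients at p and q coincide. *)
Definition depends F K := forall p q, p.1 = q.1 ->
  (forall a b, K a b -> uc p a b = uc q a b) -> F p = F q.

Lemma derive_depends F K v p q : depends F K -> p.1 = q.1 ->
  (forall a b, K a b -> uc p a b = uc q a b) -> 'D_v F p = 'D_v F q.
Proof.
move=> dF pq1 pqK; rewrite /derive.
suff -> : (fun h : R => h^-1 *: ((F \o shift p) (h *: v) - F p)) =
    (fun h : R => h^-1 *: ((F \o shift q) (h *: v) - F q)) by [].
apply/funext => h /=; rewrite (dF p q)//; congr (_ *: (_ - _)).
apply: dF => [|a b Kab]; first by rewrite /= pq1.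
by rewrite !uc_linear pqK.
Qed.

Lemma derive_jbasis_eq0 F K (c : midx r) q : depends F K ->
  ~ K (m1 c) (m2 c) -> 'D_(jbasis R (inr c)) F q = 0.
Proof.
move=> dF nKc; apply: derive_eq0 => h; apply: dF => [|a b Kab].
  by rewrite /= scaler0 add0r.
rewrite uc_linear.
have [/midx_exists[d [da db]]|hab] := leqP (a + b) r; last first.
  by rewrite !(uc_out _ hab) mulr0 addr0.
have := jcoord_basis R (inr d) (inr c); rewrite /= da db => ->.
case: eqP => [[dc]|]; last by rewrite mulr0 add0r.
by case: nKc; rewrite -dc da db.
Qed.

(** A shifted coordinate enters D_i F only as the factor of a partial derivative of F, which
    vanishes for coordinates outside [K]. *)
Lemma depends_TD (i : bool) F K K' : depends F K ->
  (forall a b, K a b -> K' a b) ->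
  (forall a b, K a b -> K' (sh1 i a) (sh2 i b)) -> depends (TD i F) K'.
Proof.
move=> dF KK' KsK' p q pq1 pqK; rewrite !TDE; apply: eq_bigr => k _.
have pqD : 'D_(jbasis R k) F p = 'D_(jbasis R k) F q.
  by apply: derive_depends dF _ _ => // a b /KK'; exact: pqK.
rewrite pqD; case: k pqD => [j|c] pqD //=.
have [Kc|nKc] := pselect (K (m1 c) (m2 c)); first by rewrite pqK//; exact: KsK'.
by rewrite (derive_jbasis_eq0 _ dF nKc) !mulr0.
Qed.

End Dependence.

(** * The manifold Q_(r) and the prolonged field *)

Section Characteristic.
Variables (R : realType) (r : nat) (U : set (R * R * R)) (xi zeta : R * R * R -> R).
Hypotheses (Uo : open U) (xis : smooth_on U xi) (zetas : smooth_on U zeta).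
Implicit Types (p q : jet R r) (a b n : nat).

Let O : set (jet R r) := [set p | U (xu p)].
Let Q := Qzeta xi U zeta.

Lemma xu_continuous : continuous (@xu R r).
Proof. by move=> p; exact: (cvg_pair cvg_fst (@uc_continuous R r 0 0 p)). Qed.

Lemma open_xu : open O.
Proof. by apply: open_comp => // p _; exact: xu_continuous. Qed.

Lemma Cn_on_xu n (F : R * R * R -> R) :
  smooth_on U F -> Cn_on n O (fun p => F (xu p)).
Proof.
move=> Fs.
pose g k p := match k with 0%N => jcoord (inl false) p
  | 1%N => jcoord (inl true) p | _ => uc p 0 0 end.
have E p : xu p = (g 0 p, g 1 p, g 2 p)%N.
  by rewrite /xu /g /= -surjective_pairing.
apply: Cn_on_ext (Cn_on_comp3 (g := g) open_xu Uo _ _ (Fs n)) => //.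
- exact: open_xu.
- by move=> p _; rewrite E.
- by move=> p; rewrite /O /= E.
- case=> [|[|k]]; last exact: Cn_on_uc.
    by apply: Cn_on_fun_linear; [exact: jcoord_linear|exact: jcoord_continuous].
  by apply: Cn_on_fun_linear; [exact: jcoord_linear|exact: jcoord_continuous].
Qed.

Let X p := xi (xu p).

(* The recursion that D_1^a D_2^b Q[u] + xi u_(a+1,b) + u_(a,b+1) satisfies;
   this expression is free of derivatives of order a + b + 1, and it is also the
   prolongation coefficient eta^(a,b) (see [DcharacE] and [prol_coefE]). *)
Fixpoint low_part0 b : jet R r -> R :=
  match b with
  | 0%N => fun p => zeta (xu p)
  | b'.+1 => fun p => TD true (low_part0 b') p - TD true X p * uc p 1 b'
  end.

Fixpoint low_part a b : jet R r -> R :=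
  match a with
  | 0%N => low_part0 b
  | a'.+1 => fun p => TD false (low_part a' b) p - TD false X p * uc p a'.+1 b
  end.

(** The bound on the order serves the tangency argument; the bound on b' makes the successive
    elimination of x_2-derivatives terminate. *)
Definition lowK a b a' b' : Prop := (a' + b' <= a + b)%N /\ (b' <= b)%N.

Lemma depends_xu (F : R * R * R -> R) : depends (fun p => F (xu p)) (lowK 0 0).
Proof. by move=> p q pq pqK; rewrite /xu pq pqK. Qed.

Lemma low_part0_depends b : depends (low_part0 b) (lowK 0 b).
Proof.
elim: b => [|b IH]; first exact: depends_xu.
have D1 : depends (TD true (low_part0 b)) (lowK 0 b.+1).
  by apply: depends_TD IH _ _; rewrite /lowK /sh1 /sh2; lia.
have D2 : depends (TD true X) (lowK 0 b.+1).
  by apply: depends_TD (@depends_xu xi) _ _; rewrite /lowK /sh1 /sh2; lia.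
move=> p q pq pqK; rewrite /=; congr (_ - _ * _).
- exact: D1.
- exact: D2.
- by apply: pqK; rewrite /lowK; lia.
Qed.

Lemma low_part_depends a b : depends (low_part a b) (lowK a b).
Proof.
elim: a => [|a IH]; first exact: low_part0_depends.
have D1 : depends (TD false (low_part a b)) (lowK a.+1 b).
  by apply: depends_TD IH _ _; rewrite /lowK /sh1 /sh2; lia.
have D2 : depends (TD false X) (lowK a.+1 b).
  by apply: depends_TD (@depends_xu xi) _ _; rewrite /lowK /sh1 /sh2; lia.
move=> p q pq pqK; rewrite /=; congr (_ - _ * _).
- exact: D1.
- exact: D2.
- by apply: pqK; rewrite /lowK; lia.
Qed.

Lemma low_part0_smooth b : smooth_on O (low_part0 b).
Proof.
elim: b => [|b IH] n; first exact: Cn_on_xu.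
have Oo := open_xu.
apply: Cn_onB => //; first exact: Cn_on_TD.
apply: Cn_onM => //; last exact: Cn_on_uc.
by apply: Cn_on_TD => //; exact: Cn_on_xu.
Qed.

Lemma low_part_smooth a b : smooth_on O (low_part a b).
Proof.
elim: a => [|a IH]; first exact: low_part0_smooth.
move=> n; have Oo := open_xu.
apply: Cn_onB => //; first exact: Cn_on_TD.
apply: Cn_onM => //; last exact: Cn_on_uc.
by apply: Cn_on_TD => //; exact: Cn_on_xu.
Qed.

Lemma TD_split i F a b a' b' p : O p -> Cn_on 1 O F ->
  TD i (fun q => F q - X q * uc q a b - uc q a' b') p =
  TD i F p - TD i X p * uc p a b - X p * uc p (sh1 i a) (sh2 i b)
  - uc p (sh1 i a') (sh2 i b').
Proof.
move=> Op CF.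
have dF := CF.1 p Op; have dX := (Cn_on_xu 1 xis).1 p Op.
have du a1 b1 : differentiable (fun q => uc q a1 b1) p.
  exact: (Cn_on_uc 1 O a1 b1).1.
have dXu : differentiable (fun q => X q * uc q a b) p by exact: differentiableM.
rewrite TDB//; last exact: differentiableB.
by rewrite TDB// TDM// !TD_uc opprD addrA.
Qed.

Lemma DcharacE a b p : O p ->
  Dcharac Q a b p = low_part a b p - X p * uc p a.+1 b - uc p a b.+1.
Proof.
elim: a p => [|a IHa] p Op; last first.
  rewrite /Dcharac iterS -[LHS]/(TD false (Dcharac Q a b) p).
  rewrite (TD_ext false open_xu Op IHa) TD_split//.
  exact: low_part_smooth.
elim: b p Op => [|b IHb] p Op; last first.
  rewrite /Dcharac /= -[LHS]/(TD true (Dcharac Q 0 b) p).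
  rewrite (TD_ext true open_xu Op IHb) TD_split//.
  exact: (low_part_smooth 0 b).
by rewrite /Dcharac /= /charac /= mul1r.
Qed.

Lemma prol_coefE c p : O p -> prol_coef Q c p = low_part (m1 c) (m2 c) p.
Proof. by move=> Op; rewrite /prol_coef DcharacE//= -/(X p); ring. Qed.

(** In the definition of [low_part] all D_1 stand outside the D_2. Commuting them gives the step in
    b for every a, which tangency requires in the coordinate u_(a,b+1). *)
Lemma low_part_TD2 a b p : O p ->
  low_part a b.+1 p = TD true (low_part a b) p - TD true X p * uc p a.+1 b.
Proof.
have Oo := open_xu.
elim: a p => [|a IH] p Op //.
rewrite -[LHS]/(TD false (low_part a b.+1) p - TD false X p * uc p a.+1 b.+1).
rewrite (TD_ext false Oo Op IH).
have dT i F : Cn_on 2 O F -> differentiable (TD i F) p.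
  by move=> CF; exact: (Cn_on_TD i Oo CF).1.
have CX : Cn_on 2 O X by exact: Cn_on_xu.
have dX i := dT i _ CX.
have dH i := dT i _ (low_part_smooth a b 2).
have du a1 b1 : differentiable (fun q => uc q a1 b1) p.
  exact: (Cn_on_uc 1 O a1 b1).1.
have dM i : differentiable (fun q => TD i X q * uc q a.+1 b) p.
  by apply: differentiableM.
rewrite TDB// TDM// TD_uc.
rewrite -[low_part a.+1 b]/(fun p =>
  TD false (low_part a b) p - TD false X p * uc p a.+1 b).
rewrite TDB// TDM// TD_uc.
rewrite (TD_comm false true Oo Op (low_part_smooth a b 2)).
rewrite (TD_comm false true Oo Op CX) /sh1 /sh2.
move: (TD true (TD false (low_part a b)) p) (TD true (TD false X) p).
by move: (TD true X p) (TD false X p) => t1 t2 t3 t4; ring.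
Qed.

Lemma differentiable_Dcharac p a b : O p ->
  differentiable (Dcharac Q a b) p.
Proof.
move=> Up; have Oo := open_xu.
have dh : differentiable (low_part a b) p by exact: (low_part_smooth a b 1).1.
have dX : differentiable X p by exact: (Cn_on_xu 1 xis).1.
have du a1 b1 : differentiable (fun q => uc q a1 b1) p.
  exact: (Cn_on_uc 1 setT a1 b1).1.
apply: (@near_eq_differentiable _ _ _
  (fun q => low_part a b q - X q * uc q a.+1 b - uc q a b.+1)).
  apply: near_open Oo Up _ => q Oq; apply/esym.
  exact: DcharacE.
by do 2![apply: differentiableB => //]; exact: differentiableM.
Qed.

Lemma Dcharac_depends a b :
  depends (Dcharac Q a b : jet R r -> R) (fun a' b' => (a' + b' <= a + b + 1)%N).
Proof.
elim: a => [|a IH]; last first.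
  rewrite /Dcharac iterS; apply: (depends_TD (i := false) IH); rewrite /sh1 /sh2; lia.
elim: b => [|b IH].
  by move=> p q pq pqK; rewrite /Dcharac /= /charac /= /xu pq !pqK.
by rewrite /Dcharac iterS; apply: (depends_TD (i := true) IH); rewrite /sh1 /sh2; lia.
Qed.

End Characteristic.

Section CharacteristicManifold.
Variables (R : realType) (r : nat) (U : set (R * R * R)) (xi zeta : R * R * R -> R).
Hypotheses (Uo : open U) (xis : smooth_on U xi) (zetas : smooth_on U zeta).
Implicit Types (p q : jet R r) (a b n : nat).

Let O : set (jet R r) := [set p | U (xu p)].
Let Q := Qzeta xi U zeta.
Let X p := xi (xu p).
Let h a b : jet R r -> R := low_part xi zeta a b.

(** The r-th prolongation of Q as a tangent vector at p. *)
Definition prolvec p : jet R r :=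
  ((X p, 1), \row_i h (m1 (enum_val i)) (m2 (enum_val i)) p).

Lemma uc_prolvec p a b : (a + b <= r)%N -> uc (prolvec p) a b = h a b p.
Proof. by move=> /midx_exists[c [<- <-]]; rewrite ucE mxE enum_rankK. Qed.

Lemma derive_uc v p a b : 'D_v (fun q => uc q a b) p = uc v a b.
Proof.
exact: (derive_fun_linear p (uc_linear a b) (@uc_continuous R r a b)).2.
Qed.

(* On the manifold the prolonged field agrees with [xi D_1 + D_2] in all
   coordinates of order < r. *)
Lemma derive_prolvec_low p (F : jet R r -> R) a b : Qman Q p -> (a + b < r)%N ->
  differentiable F p -> depends F (lowK a b) ->
  'D_(prolvec p) F p = X p * TD false F p + TD true F p.
Proof.
move=> [Up Qp] abr dF Fab; rewrite derive_jcoord// !TDE mulr_sumr -big_split.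
apply: eq_bigr => k _ /=; rewrite mulrA -mulrDl.
case: k => [[]|c] /=; rewrite ?mulr0 ?mulr1 ?add0r ?addr0//.
have [[Kc _]|nKc] := pselect (lowK a b (m1 c) (m2 c)); last first.
  by rewrite (derive_jbasis_eq0 _ Fab nKc) !mulr0.
congr (_ * _); rewrite uc_prolvec ?midx_le//.
have /eqP := Qp _ _ (leq_ltn_trans Kc abr).
by rewrite DcharacE// -addrA -opprD subr_eq0 => /eqP.
Qed.

(** Tangency of the prolonged field to Q_(r). With h for [low_part], v acts on h_(a,b) and xi as xi
    D_1 + D_2, while its components at u_(a+1,b) and u_(a,b+1) are D_i h_(a,b) - (D_i xi) u_(a+1,b)
    for i = 1, 2; everything cancels. *)
Lemma derive_Dcharac_prolvec p a b : Qman Q p -> (a + b < r)%N ->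
  'D_(prolvec p) (Dcharac Q a b) p = 0.
Proof.
move=> Qp abr; have Op : O p := Qp.1.
have Oo : open O := @open_xu R r U Uo.
have dh : differentiable (h a b) p by exact: (low_part_smooth r Uo xis zetas a b 1).1.
have dX : differentiable X p by exact: (Cn_on_xu r Uo 1 xis).1.
have du a1 b1 : differentiable (fun q => uc q a1 b1) p.
  exact: (Cn_on_uc 1 O a1 b1).1.
have dXu : differentiable (fun q => X q * uc q a.+1 b) p by exact: differentiableM.
rewrite (near_eq_derive _
  (g := fun q => h a b q - X q * uc q a.+1 b - uc q a b.+1)); last first.
  by apply: near_open Oo Op _ => q Oq; exact: (DcharacE Uo xis zetas).
have -> : 'D_(prolvec p) (fun q => h a b q - X q * uc q a.+1 b - uc q a b.+1) p =
    'D_(prolvec p) (h a b) p - 'D_(prolvec p) (fun q => X q * uc q a.+1 b) p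
    - 'D_(prolvec p) (fun q => uc q a b.+1) p.
  rewrite -deriveB; [|exact: diff_derivable..].
  by apply: deriveB; apply: diff_derivable => //; exact: differentiableB.
have -> : 'D_(prolvec p) (fun q => X q * uc q a.+1 b) p =
    X p * 'D_(prolvec p) (fun q => uc q a.+1 b) p + uc p a.+1 b * 'D_(prolvec p) X p.
  by apply: deriveM; exact: diff_derivable.
rewrite !derive_uc !uc_prolvec ?addSn ?addnS//.
rewrite (derive_prolvec_low Qp abr dh (@low_part_depends R r xi zeta a b)).
rewrite (derive_prolvec_low (a := 0) (b := 0) Qp _ dX (@depends_xu R r xi)); last first.
  exact: leq_ltn_trans abr.
rewrite [h a b.+1 p](low_part_TD2 Uo xis zetas a b Op).
rewrite -[h a.+1 b p]/(TD false (h a b) p - TD false X p * uc p a.+1 b).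
rewrite -/h -/X; move: (TD true (h a b) p) (TD false (h a b) p).
by move: (TD true X p) (TD false X p) => t1 t2 t3 t4; ring.
Qed.

(* Replaces every u_(a,b+1) by the value prescribed by D_1^a D_2^b Q[u] = 0;
   its fixed points are the points of the manifold. *)
Definition tcoef (k : jindex r) p : R :=
  if k is inr c then if m2 c is b.+1 then Dcharac Q (m1 c) b p else 0 else 0.

Definition retract p : jet R r :=
  p + \sum_(k <- enum (jindex r)) tcoef k p *: jbasis R k.

Lemma jcoord_retract k p : jcoord k (retract p) = jcoord k p + tcoef k p.
Proof.
rewrite /retract -[p in p + _]scale1r jcoord_linear mul1r jcoord_sum; congr (_ + _).
under eq_bigr do rewrite jcoord_basis.
rewrite big_enum /= (bigD1 k)//= eqxx mulr1 big1 ?addr0// => l lk.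
by rewrite eq_sym (negbTE lk) mulr0.
Qed.

Lemma retract1 p : (retract p).1 = p.1.
Proof.
rewrite [LHS]surjective_pairing [RHS]surjective_pairing.
have := jcoord_retract (inl false) p; have := jcoord_retract (inl true) p.
by rewrite /= !addr0 => -> ->.
Qed.

Lemma uc_retract0 p a : uc (retract p) a 0 = uc p a 0.
Proof.
have [/midx_exists[c [<- c0]]|ar] := leqP (a + 0) r; last by rewrite !uc_out.
by have := jcoord_retract (inr c) p; rewrite /= c0 addr0.
Qed.

Lemma uc_retractS p a b : (a + b < r)%N ->
  uc (retract p) a b.+1 = uc p a b.+1 + Dcharac Q a b p.
Proof.
rewrite -addnS => /midx_exists[c [<- cb]].
by have := jcoord_retract (inr c) p; rewrite /= cb.
Qed.

Lemma xu_retract p : xu (retract p) = xu p.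
Proof. by rewrite /xu retract1 uc_retract0. Qed.

Lemma xu_iter_retract n p : xu (iter n retract p) = xu p.
Proof. by elim: n => [//|n IH]; rewrite iterS xu_retract. Qed.

Lemma retract_fix p : Qman Q p -> retract p = p.
Proof.
move=> [_ Qp]; apply: jcoord_ext => k; rewrite jcoord_retract.
case: k => [k|c]; rewrite /= ?addr0//; have := midx_le c.
by case: (m2 c) => [|b] hc; rewrite ?addr0// Qp ?addr0// -addnS.
Qed.

(* D_1^a D_2^b (zeta - xi u_1) only involves derivatives with at most b
   differentiations in x_2, so the n-th iterate is final in the coordinates
   u_(a,b) with b <= n. *)
Lemma Dcharac_iter_retract n p a b : O p -> (b < n)%N -> (a + b < r)%N ->
  Dcharac Q a b (iter n retract p) = 0.
Proof.
move=> Op; elim: n a b => [//|n IH] a b bn abr.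
set s := iter n retract p.
have Os : O s by rewrite /O /= xu_iter_retract.
have stable a' b' : (a' + b' <= r)%N -> (b' <= n)%N ->
    uc (retract s) a' b' = uc s a' b'.
  case: b' => [|b'] abr' bn'; first exact: uc_retract0.
  by rewrite uc_retractS ?IH ?addr0// -addnS.
rewrite iterS -/s (DcharacE Uo xis zetas); last by rewrite /= xu_retract.
rewrite uc_retractS// (DcharacE Uo xis zetas)// xu_retract.
rewrite (stable a.+1 b) ?addSn//.
rewrite (low_part_depends xi zeta (p := retract s) (q := s)); first by ring.
  exact: retract1.
by move=> a' b' [h1 h2]; apply: stable; lia.
Qed.

Lemma Qman_iter_retract p : O p -> Qman Q (iter r retract p).
Proof.
move=> Op; split; first by rewrite /= xu_iter_retract.
move=> a b abr; apply: Dcharac_iter_retract => //.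
exact: leq_ltn_trans (leq_addl _ _) abr.
Qed.

(** The corrections added by [retract] are expressions D_1^a D_2^b Q[u], whose derivatives along the
    prolonged field vanish by tangency, so one step fixes this vector. All iterates fix p, hence the
    chain rule never leaves p. *)
Lemma differentiable_iter_retract n p : Qman Q p ->
  differentiable (iter n retract) p /\
  'd (iter n retract) p (prolvec p) = prolvec p.
Proof.
move=> Qp; have Op : O p := Qp.1.
have fixn m : iter m retract p = p.
  by elim: m => [//|m IH]; rewrite iterS IH; exact: retract_fix.
have dD a b : differentiable (Dcharac Q a b) p.
  exact: (differentiable_Dcharac Uo xis zetas).
have dt k : differentiable (tcoef k) p.
  case: k => [k|c] /=; first exact: differentiable_cst.
  by rewrite /tcoef; case: (m2 c) => [|b]; [exact: differentiable_cst|exact: dD].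
have dt0 k : 'd (tcoef k) p (prolvec p) = 0.
  rewrite -deriveE//; case: k {dt} => [k|c] /=; first exact: derive_cst.
  rewrite /tcoef; have := midx_le c.
  case: (m2 c) => [|b] hc; first exact: derive_cst.
  by apply: derive_Dcharac_prolvec => //; rewrite -addnS.
have [dS dSE] := differentiable_lincomb (enum (jindex r)) (jbasis R (r := r)) dt.
have di : differentiable (id : jet R r -> jet R r) p by [].
have did w : 'd (id : jet R r -> jet R r) p w = w by rewrite -deriveE// derive_id.
have dR : differentiable retract p.
  exact: (differentiableD di dS).
have dRE : 'd retract p (prolvec p) = prolvec p.
  apply: etrans (congr1 (@^~ (prolvec p)) (diffD di dS)) _.
  apply: etrans (_ : prolvec p + 0 = _); last exact: addr0.
  congr (_ + _); first exact: did.
  by apply: etrans (dSE _) _; rewrite big1// => k _; rewrite dt0 scale0r.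
elim: n => [|n [IHd IHv]].
  have -> : iter 0 retract = id by [].
  by split; [exact: di|exact: did].
have dRn : differentiable retract (iter n retract p) by rewrite fixn.
split; first exact: (differentiable_comp IHd dRn).
apply: etrans (congr1 (@^~ (prolvec p)) (diff_comp IHd dRn)) _.
apply: etrans (congr1 ('d retract (iter n retract p)) IHv) _.
exact: etrans (congr1 (fun x => 'd retract x (prolvec p)) (fixn n)) dRE.
Qed.

End CharacteristicManifold.

Section ProlongationOnManifold.
Variables (R : realType) (r : nat) (U : set (R * R * R)) (xi zeta : R * R * R -> R).
Hypotheses (Uo : open U) (xis : smooth_on U xi) (zetas : smooth_on U zeta).

Let Q := Qzeta xi U zeta.

Lemma differentiable_xuu1 (p : jet R r) :
  differentiable (@xuu1 R r) p /\ forall v, 'd (@xuu1 R r) p v = xuu1 v.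
Proof.
have fl : linear (@xuu1 R r).
  by move=> t p1 p2; rewrite /xuu1 !uc_linear.
have fc : continuous (@xuu1 R r).
  move=> q; have c1 : {for q, continuous (fun q : jet R r => (q.1, uc q 0 0))}.
    exact: xu_continuous.
  exact: (cvg_pair c1 (@uc_continuous R r 1 0 q)).
pose L : {linear jet R r -> (R * R * R * R)%type} := HB.pack (@xuu1 R r)
  (GRing.isLinear.Build _ _ _ _ _ fl).
split; first exact: (linear_differentiable (f := L)).
by move=> v; exact: (congr1 (@^~ v) (diff_lin (f := L) p fc)).
Qed.

Lemma prolong_derive (L : jet R r -> R) (p : jet R r) : U (xu p) ->
  differentiable L p -> prolong Q L p = 'D_(prolvec xi zeta p) L p.
Proof.
move=> Up dL; rewrite derive_jcoord// big_sumType big_bool /= mul1r.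
rewrite /prolong /= mul1r [X in X + _]addrC; congr (_ + _).
apply: eq_bigr => c _; congr (_ * _).
by rewrite (prol_coefE Uo xis zetas)// uc_prolvec// midx_le.
Qed.

(* L and Lt o xuu1 agree after composition with the retraction onto the
   manifold, whose differential fixes the prolonged field. *)
Lemma prolong_eliminated (Om : set (jet R r)) (L : jet R r -> R) W Lt p :
  (0 < r)%N -> open Om -> Om p -> Qman Q p -> differentiable L p ->
  eliminated Om L Q W Lt ->
  prolong Q L p =
  'D_((xi (xu p), 1), low_part xi zeta 0 0 p, low_part xi zeta 1 0 p) Lt (xuu1 p).
Proof.
move=> r0 Omo Omp Qp dL [Wo Lts LLt]; set v := prolvec xi zeta p.
have Up : U (xu p) := Qp.1.
have vE : (xi (xu p), 1, low_part xi zeta 0 0 p, low_part xi zeta 1 0 p) = xuu1 v.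
  by rewrite /xuu1 /v !uc_prolvec.
rewrite prolong_derive// -/v vE.
pose T : jet R r -> jet R r := iter r (@retract R r U xi zeta).
have [dT dTv] : differentiable T p /\ 'd T p v = v.
  exact: (differentiable_iter_retract Uo xis zetas).
have Tp : T p = p.
  suff E m : iter m (@retract R r U xi zeta) p = p by exact: E.
  by elim: m => [//|m IH]; rewrite iterS IH; exact: retract_fix.
have dLt : differentiable Lt (xuu1 p) by apply: (Lts 1%N).1; exact: (LLt p Omp Qp).1.
have [dx dxE] := differentiable_xuu1 p.
have nearE : \forall q \near p, L (T q) = Lt (xuu1 (T q)).
  have nU : \forall q \near p, U (xu q).
    apply: open_nbhs_nbhs; split => //; exact: open_xu.
  (* Continuity of [T] at its fixed point p keeps the retracted jets in the domain of L. *)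
  have nOm : \forall q \near p, Om (T q).
    have := differentiable_continuous dT; apply.
    by rewrite Tp; apply: open_nbhs_nbhs.
  apply: filterS2 nU nOm => q Uq Omq; apply: (LLt _ Omq _).2.
  exact: (Qman_iter_retract Uo xis zetas).
have := near_eq_derive v nearE.
have dL' : differentiable L (T p) by rewrite Tp.
have dx' : differentiable (@xuu1 R r) (T p) by rewrite Tp.
have dLt' : differentiable Lt (xuu1 (T p)) by rewrite Tp.
have dxT := differentiable_comp dT dx'.
have e1 : 'D_v (L \o T) p = 'D_v L p.
  apply: etrans (deriveE _ (differentiable_comp dT dL')) _.
  apply: etrans (congr1 (@^~ v) (diff_comp dT dL')) _.
  apply: etrans (congr1 ('d L (T p)) dTv) _.
  by apply: etrans (congr1 (fun q => 'd L q v) Tp) _; rewrite deriveE.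
have e2 : 'D_v (Lt \o (@xuu1 R r \o T)) p = 'D_(xuu1 v) Lt (xuu1 p).
  apply: etrans (deriveE _ (differentiable_comp dxT dLt')) _.
  apply: etrans (congr1 (@^~ v) (diff_comp dxT dLt')) _.
  apply: etrans (congr1 (fun q => 'd Lt (xuu1 q) ('d (@xuu1 R r \o T) p v)) Tp) _.
  rewrite deriveE//; congr ('d Lt (xuu1 p) _).
  apply: etrans (congr1 (@^~ v) (diff_comp dT dx')) _.
  apply: etrans (congr1 ('d (@xuu1 R r) (T p)) dTv) _.
  exact: etrans (congr1 (fun q => 'd (@xuu1 R r) q v) Tp) (dxE v).
by move=> e0; exact: etrans (esym e1) (etrans e0 e2).
Qed.

End ProlongationOnManifold.

(** * Total derivatives along jets of functions *)

Section JetsOfFunctions.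
Variables (R : realType) (r : nat) (N : set (R * R)) (g : R * R -> R).
Hypotheses (No : open N) (gs : smooth_on N g).
Implicit Types (y : R * R) (i : bool).

Definition ebasis i : R * R := if i then (0, 1) else (1, 0).

Let dg a b := iter a (@px1 R) (iter b (@px2 R) g).

Lemma dg_smooth a b : smooth_on N (dg a b).
Proof.
elim: a => [|a IH] n; last exact: (IH n.+1).2.
elim: b n => [|b IH] n; first exact: gs.
exact: (IH n.+1).2.
Qed.

(** Jets take the x_2-derivatives innermost, so a further one is commuted inwards past the
    x_1-derivatives. *)
Lemma px2_dg a b y : N y -> px2 (dg a b) y = dg a b.+1 y.
Proof.
elim: a y => [//|a IH] y Ny.
rewrite -[LHS]/('D_(0, 1) ('D_(1, 0) (dg a b)) y).
rewrite (derive_comm _ _ No Ny (dg_smooth a b 2)).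
rewrite -[RHS]/('D_(1, 0) (dg a b.+1) y).
by apply: near_eq_derive; exact: near_open No Ny IH.
Qed.

Lemma uc_jet_of a b y : (a + b <= r)%N -> uc (jet_of r g y) a b = dg a b y.
Proof. by move=> /midx_exists[c [<- <-]]; rewrite ucE mxE enum_rankK. Qed.

(** The characteristic property of total derivatives. The restriction to orders below r excludes the
    coordinates whose shifts the truncation replaces by 0. *)
Lemma derive_jet_of i (F : jet R r -> R) y :
  N y -> differentiable F (jet_of r g y) ->
  depends F (fun a b => (a + b < r)%N) ->
  'D_(ebasis i) (fun y => F (jet_of r g y)) y = TD i F (jet_of r g y).
Proof.
move=> Ny dF Fr.
pose cf (k : jindex r) y := jcoord k (jet_of r g y).
have E : (fun y => F (jet_of r g y)) =
      (fun y => F (\sum_(k <- enum (jindex r)) cf k y *: jbasis R k)).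
  by apply/funext => z; rewrite -jet_lincomb.
have fs2 (z : R * R) : differentiable (snd : R * R -> R) z /\
    forall v, 'D_v (snd : R * R -> R) z = v.2.
  by apply: derive_fun_linear => // w; exact: cvg_snd.
have fs1 (z : R * R) : differentiable (fst : R * R -> R) z /\
    forall v, 'D_v (fst : R * R -> R) z = v.1.
  by apply: derive_fun_linear => // w; exact: cvg_fst.
have dcf k : differentiable (cf k) y.
  case: k => [[]|c].
  - exact: (fs2 y).1.
  - exact: (fs1 y).1.
  - have -> : cf (inr c) = dg (m1 c) (m2 c).
      by apply/funext => z; rewrite /cf /= uc_jet_of// midx_le.
    exact: (dg_smooth _ _ 1).1.
rewrite E derive_comp_lincomb//; last by rewrite -jet_lincomb.
rewrite -jet_lincomb TDE big_enum /=; apply: eq_bigr => k _.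
case: k => [j|c].
  congr (_ * _).
  have -> : 'D_(ebasis i) (cf (inl j)) y = (if j then (ebasis i).2 else (ebasis i).1).
    by case: j; [exact: (fs2 y).2|exact: (fs1 y).2].
  by rewrite /tdcoef /ebasis; case: i; case: j.
have [cr|rc] := ltnP (m1 c + m2 c) r; last first.
  by rewrite (derive_jbasis_eq0 _ Fr) ?mulr0//; apply/negP; rewrite -leqNgt.
congr (_ * _).
have -> : cf (inr c) = dg (m1 c) (m2 c).
  by apply/funext => z; rewrite /cf /= uc_jet_of// midx_le.
rewrite /tdcoef uc_jet_of; last by case: (i); rewrite /sh1 /sh2 ?addnS ?addSn.
by case: (i) => //; exact: px2_dg.
Qed.

(** Invariance holds on an open set of x and may therefore be differentiated there: each
    differential consequence of Q[u] = 0, evaluated on the jets, is the derivative of a function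
    that vanishes on that set. *)
Lemma Dcharac_jet_of (U : set (R * R * R)) (xi zeta : R * R * R -> R) a b y :
  open U -> smooth_on U xi -> smooth_on U zeta ->
  (forall y, N y -> U (y, g y)) ->
  (forall y, N y -> charac (Qzeta xi U zeta) (jet_of r g y) = 0) ->
  N y -> (a + b < r)%N -> Dcharac (Qzeta xi U zeta) a b (jet_of r g y) = 0.
Proof.
move=> Uo xis zetas NU N0.
have xuN z : N z -> U (xu (jet_of r g z)).
  by move=> Nz; rewrite /xu uc_jet_of//; exact: NU.
pose D a b : jet R r -> R := Dcharac (Qzeta xi U zeta) a b.
have step i a' b' z : N z -> (a' + b' + 1 < r)%N ->
    (forall z, N z -> D a' b' (jet_of r g z) = 0) ->
    TD i (D a' b') (jet_of r g z) = 0.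
  move=> Nz abr' D0; rewrite -derive_jet_of//.
  - rewrite (near_eq_derive _ (g := cst 0)) ?derive_cst//.
    exact: near_open No Nz D0.
  - by apply: (differentiable_Dcharac Uo xis zetas); exact: xuN.
  - move=> p q pq pqr; apply: (@Dcharac_depends R r U xi zeta a' b' p q pq) => a1 b1 h1.
    by apply: pqr; lia.
elim: a y => [|a IHa] y; last first.
  move=> Ny abr; apply: (step false a b) => //; first lia.
  by move=> z Nz; apply: IHa => //; lia.
elim: b y => [|b IHb] y; first by move=> Ny _; exact: N0.
move=> Ny abr; apply: (step true 0 b) => //; first lia.
by move=> z Nz; apply: IHb => //; lia.
Qed.

End JetsOfFunctions.

(** * One-parametric families of solutions *)

Section Slices.
Variable R : realType.
Implicit Types (f : R * R * R -> R) (V : set (R * R * R)) (k : R).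

Lemma derive_slice f k (v y : R * R) :
  'D_v (fun y => f (y, k)) y = 'D_((v, 0) : R * R * R) f (y, k).
Proof.
rewrite /derive.
suff -> : (fun h : R => h^-1 *: (((fun y => f (y, k)) \o shift y) (h *: v) - f (y, k))) =
    (fun h : R => h^-1 *: ((f \o shift (y, k)) (h *: (v, 0)) - f (y, k))) by [].
apply/funext => h; congr (_ *: (f _ - _)).
by rewrite pairZ /shift /= pairD scaler0 add0r.
Qed.

Lemma slice_continuous k : continuous (fun y : R * R => (y, k)).
Proof. by move=> y; exact: (cvg_pair cvg_id (cvg_cst k)). Qed.

Lemma open_slice V k : open V -> open [set y | V (y, k)].
Proof. by move=> Vo; apply: open_comp => // y _; exact: slice_continuous. Qed.

Lemma smooth_slice f V k : open V -> smooth_on V f ->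
  smooth_on [set y | V (y, k)] (fun y => f (y, k)).
Proof.
move=> Vo fs n.
pose g i (y : R * R) := match i with 0%N => y.1 | 1%N => y.2 | _ => k end.
have E (y : R * R) : (y, k) = (g 0 y, g 1 y, g 2 y)%N.
  by rewrite /g -surjective_pairing.
have so := @open_slice V k Vo.
apply: Cn_on_ext (Cn_on_comp3 (g := g) so Vo _ _ (fs n)) => //.
- by move=> y _; rewrite -E.
- by move=> y; rewrite -E.
- case=> [|[|i]]; last exact: Cn_on_cst.
    by apply: Cn_on_fun_linear => // y; exact: cvg_fst.
  by apply: Cn_on_fun_linear => // y; exact: cvg_snd.
Qed.

Lemma derive_direction f z (a : R) : differentiable f z ->
  'D_((a, 1, 0) : R * R * R) f z =
  'D_((0, 1, 0) : R * R * R) f z + a * 'D_((1, 0, 0) : R * R * R) f z.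
Proof.
move=> dF; rewrite !deriveE//.
have -> : (a, 1, 0) = (0, 1, 0) + a *: (1, 0, 0) :> R * R * R.
  by rewrite !pairZ !pairD !scaler0 !addr0 add0r /GRing.scale /= mulr1.
by rewrite linearD linearZ.
Qed.

End Slices.

(** * Elimination of x_2-derivatives when the co-order is 0 or 1 *)

Section Elimination.
Variables (R : realType) (r : nat) (U : set (R * R * R)) (xi zeta : R * R * R -> R).
Hypotheses (Uo : open U) (xis : smooth_on U xi) (zetas : smooth_on U zeta).

Let Q := Qzeta xi U zeta.

(** The coordinates of the jet over (x, u, u_1) whose u_2 is prescribed by Q[u] = 0. Only orders a +
    b <= 1 are meaningful. *)
Let ecoef (w : R * R * R * R) (a b : nat) : R :=
  if b is _.+1 then zeta w.1 - xi w.1 * w.2 else if a is _.+1 then w.2 else w.1.2.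

Let emb n (w : R * R * R * R) : jet R n :=
  (w.1.1, \row_i ecoef w (m1 (enum_val i)) (m2 (enum_val i))).

(** The co-order supplies a function on J^n, whereas maximal rank concerns functions of (x, u, u_1);
    pulling back along [emb] passes from one to the other. For n = 0 the embedding forgets u_1,
    hence the last clause. *)
Lemma eliminated_of_order_le (Om : set (jet R r)) (L : jet R r -> R) (n : nat) :
  (0 < r)%N -> (n <= 1)%N -> order_le (Om `&` Qman Q) L n%:Z ->
  exists W Lt, eliminated Om L Q W Lt /\
    (n = 0%N -> forall w, 'D_((0, 0, 0, 1) : R * R * R * R) Lt w = 0).
Proof.
move=> r0 n1 [Wn [Gn [Wno Gns LG]]].
pose O4 : set (R * R * R * R) := [set w | U w.1].
have O4o : open O4 by apply: open_comp => // w _; exact: cvg_fst.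
have c4 : forall k w, jcoord k (emb n w) =
    match k with inl false => w.1.1.1 | inl true => w.1.1.2
               | inr c => ecoef w (m1 c) (m2 c) end.
  by move=> [[]|c] w //=; rewrite ucE mxE enum_rankK.
have fc1 : continuous (fun w : R * R * R * R => w.1) by move=> w; exact: cvg_fst.
have fc11 : continuous (fun w : R * R * R * R => w.1.1).
  by move=> w; apply: (continuous_comp (fc1 w)); exact: cvg_fst.
have L4 m (F : R * R * R * R -> R) :
    (forall (k : R) v w, F (k *: v + w) = k * F v + F w) -> continuous F ->
    Cn_on m O4 F by exact: Cn_on_fun_linear.
have C111 m : Cn_on m O4 (fun w => w.1.1.1).
  by apply: L4 => // w; apply: (continuous_comp (fc11 w)); exact: cvg_fst.
have C112 m : Cn_on m O4 (fun w => w.1.1.2).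
  by apply: L4 => // w; apply: (continuous_comp (fc11 w)); exact: cvg_snd.
have C12 m : Cn_on m O4 (fun w => w.1.2).
  by apply: L4 => // w; apply: (continuous_comp (fc1 w)); exact: cvg_snd.
have C2 m : Cn_on m O4 (fun w => w.2).
  by apply: L4 => // w; exact: cvg_snd.
have CF m F : smooth_on U F -> Cn_on m O4 (fun w => F w.1).
  move=> Fs.
  pose g i (w : R * R * R * R) :=
    match i with 0%N => w.1.1.1 | 1%N => w.1.1.2 | _ => w.1.2 end.
  have E (w : R * R * R * R) : w.1 = (g 0 w, g 1 w, g 2 w)%N.
    by rewrite /g -!surjective_pairing.
  apply: Cn_on_ext (Cn_on_comp3 (g := g) O4o Uo _ _ (Fs m)) => //.
  - by move=> w _; rewrite -E.
  - by move=> w; rewrite -E.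
  - by case=> [|[|i]]; [exact: C111|exact: C112|exact: C12].
have Cc m k : Cn_on m O4 (fun w => jcoord k (emb n w)).
  have CE : Cn_on m O4 (fun w => match k with inl false => w.1.1.1
    | inl true => w.1.1.2 | inr c => ecoef w (m1 c) (m2 c) end).
    case: k => [[]|c]; [exact: C112|exact: C111|].
    case: (m2 c) => [|b]; first by case: (m1 c) => [|a]; [exact: C12|exact: C2].
    apply: Cn_onB => //; first exact: CF.
    by apply: Cn_onM => //; exact: CF.
  by apply: Cn_on_ext CE => // w _; rewrite c4.
have embE w : emb n w = \sum_(k <- enum (jindex n)) jcoord k (emb n w) *: jbasis R k.
  exact: jet_lincomb.
have embc w : O4 w -> {for w, continuous (emb n)}.
  move=> Ow; apply: differentiable_continuous.
  have -> : emb n =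
    (fun w => \sum_(k <- enum (jindex n)) jcoord k (emb n w) *: jbasis R k).
    exact/funext.
  have dk k : differentiable (fun w => jcoord k (emb n w)) w by exact: (Cc 1%N k).1.
  exact: (differentiable_lincomb (enum (jindex n)) (jbasis R (r := n)) dk).1.
pose W : set (R * R * R * R) := [set w | O4 w /\ Wn (emb n w)].
have Wo : open W.
  rewrite openE => w [Ow Ww]; apply: filterI; first exact: open_nbhs_nbhs.
  by apply: (embc w Ow); exact: open_nbhs_nbhs.
exists W, (fun w => Gn (emb n w)); split; last first.
  move=> n0 w; apply: derive_eq0 => h; congr Gn.
  apply: jcoord_ext => k; rewrite !c4.
  have E1 : (h *: (0, 0, 0, 1) + w).1 = w.1 :> R * R * R.
    by case: w => [w1 w2]; rewrite pairZ pairD /= scaler0 add0r.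
  case: k => [[]|c]; rewrite ?E1//.
  have := midx_le c; rewrite [in X in (_ <= X)%N -> _]n0 leqn0 addn_eq0.
  by move=> /andP[/eqP -> /eqP ->]; rewrite /ecoef E1.
split=> //.
  move=> m; have -> : (fun w => Gn (emb n w)) =
      (fun w => Gn (\sum_(k <- enum (jindex n)) jcoord k (emb n w) *: jbasis R k)).
    by apply/funext => w; rewrite -embE.
  apply: (Cn_on_comp (U' := Wn)) => //.
  - by move=> w [_ Ww]; rewrite -embE.
  - by move=> k; apply: Cn_on_subset (Cc m k) => w [].
move=> p Omp Qp; have [Wp ->] := LG p (conj Omp Qp).
suff E : jproj n p = emb n (xuu1 p).
  by rewrite E in Wp *; split=> //; split=> //; exact: Qp.1.
apply: jcoord_ext => k; rewrite c4.
case: k => [[]|c] //=.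
rewrite ucE mxE enum_rankK.
have := midx_le c; move: (m1 c) (m2 c) => a b abn.
have := Qp.2 0%N 0%N r0; rewrite /Dcharac /= /charac /= mul1r => /eqP.
rewrite subr_eq0 => /eqP E0.
(* Only u, u_1 and u_2 survive the bound n <= 1, and u_2 is given by [E0]. *)
case: a b abn => [|[|a]] [|[|b]] //= abn; try by (exfalso; lia).
Qed.

End Elimination.

(** * Jets of the members of a family *)

Section FamilyJets.
Variables (R : realType) (f Phi xi : R * R * R -> R) (B U : set (R * R * R)).
Hypotheses (Bo : open B) (Uo : open U) (fs : smooth_on B f).
Hypotheses (xis : smooth_on U xi) (Phis : smooth_on U Phi).
Hypotheses (UB : forall z, U z -> B (z.1, Phi z)).
Hypotheses (BU : forall x k, B (x, k) -> U (x, f (x, k)) /\ Phi (x, f (x, k)) = k).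

Let f1 := 'D_((1, 0, 0) : R * R * R) f.
Let f2 := 'D_((0, 1, 0) : R * R * R) f.

Definition family_zeta (z : R * R * R) : R :=
  f2 (z.1, Phi z) + xi z * f1 (z.1, Phi z).

Let Q := Qzeta xi U family_zeta.

Lemma family_zeta_smooth : smooth_on U family_zeta.
Proof.
have C v n : Cn_on n U (fun z => 'D_v f (z.1, Phi z)).
  exact: (Cn_on_graph Uo Bo UB (Phis n) (smooth_derive v fs n)).
move=> n; apply: Cn_onD => //; first exact: C.
by apply: Cn_onM => //; exact: C.
Qed.

Section Jets.
Variables (r : nat) (x : R * R) (k : R).
Hypothesis Bxk : B (x, k).

Let q := jet_of r (fun y => f (y, k)) x.

Lemma xu_family : xu q = (x, f (x, k)).
Proof. by rewrite /xu uc_jet_of. Qed.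

Lemma charac_family : (0 < r)%N -> charac Q q = 0.
Proof.
move=> r0; rewrite /charac xu_family !uc_jet_of//= /px1 /px2 !derive_slice.
by rewrite /family_zeta /= (BU Bxk).2 mul1r addrK subrr.
Qed.

Lemma px1_family : px1 (fun y => f (y, k)) = (fun y => f1 (y, k)).
Proof. by apply/funext => y; exact: derive_slice. Qed.

Lemma px2_family : px2 (fun y => f (y, k)) = (fun y => f2 (y, k)).
Proof. by apply/funext => y; exact: derive_slice. Qed.

Lemma xuu1_family : (0 < r)%N -> xuu1 q = (x, f (x, k), f1 (x, k)).
Proof.
move=> r0; rewrite /xuu1 !uc_jet_of//.
by congr (_, _); exact: derive_slice.
Qed.

Lemma uc_family11 : (1 < r)%N -> uc q 1 1 = 'D_((0, 1, 0) : R * R * R) f1 (x, k).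
Proof.
move=> r1; rewrite uc_jet_of; last exact: r1.
rewrite -[LHS]/(px1 (px2 (fun y => f (y, k))) x) px2_family.
apply: etrans (derive_slice f2 k (1, 0) x) _.
exact: (@derive_comm R (R * R * R)%type f B (x, k) (1, 0, 0) (0, 1, 0) Bo Bxk (fs 2%N)).
Qed.

Lemma uc_family20 : (1 < r)%N -> uc q 2 0 = 'D_((1, 0, 0) : R * R * R) f1 (x, k).
Proof.
move=> r1; rewrite uc_jet_of; last by rewrite addn0.
rewrite -[LHS]/(px1 (px1 (fun y => f (y, k))) x) px1_family.
exact: derive_slice.
Qed.

End Jets.

Lemma Qman_family r x k : (0 < r)%N -> B (x, k) ->
  Qman Q (jet_of r (fun y => f (y, k)) x).
Proof.
move=> r0 Bxk; split; first by rewrite xu_family; exact: (BU Bxk).1.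
move=> a b abr.
apply: (@Dcharac_jet_of R r [set y | B (y, k)] (fun y => f (y, k))) => //.
- exact: open_slice.
- exact: smooth_slice.
- exact: family_zeta_smooth.
- by move=> y /BU[].
- by move=> y By; exact: charac_family.
Qed.

(** The coefficient eta^(1,0) is a function of (x, u, u_1) only, so it may be computed at the jet of
    the family member through the same point. There D_1 Q[u] = 0, an equation of Q_(r) because r >
    1, gives it the value xi f_11 + f_12. *)
Lemma low_part_family r (p : jet R r) x k : (1 < r)%N -> B (x, k) ->
  xuu1 p = (x, f (x, k), f1 (x, k)) ->
  low_part xi family_zeta 0 0 p = 'D_((xi (xu p), 1, 0) : R * R * R) f (x, k) /\
  low_part xi family_zeta 1 0 p = 'D_((xi (xu p), 1, 0) : R * R * R) f1 (x, k).
Proof.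
move=> r1 Bxk pE; have r0 := ltnW r1.
have xup : xu p = (x, f (x, k)) by case: pE => e1 e2 _; rewrite /xu e1 e2.
pose q := jet_of r (fun y => f (y, k)) x.
have xuq : xu q = xu p by rewrite xup; exact: xu_family.
split.
  rewrite derive_direction; last exact: (fs 1%N).1.
  by rewrite /= /family_zeta xup /= (BU Bxk).2.
rewrite derive_direction; last exact: (smooth_derive _ fs 1%N).1.
have -> : low_part xi family_zeta 1 0 p = low_part xi family_zeta 1 0 q.
  have E : xuu1 p = xuu1 q by rewrite pE; apply/esym; exact: xuu1_family.
  case: E => E1 E2 E3; apply: low_part_depends => // a b [h1].
  by case: b h1 => [|//]; case: a => [|[|a]].
have := (Qman_family r0 Bxk).2 1%N 0%N r1.
rewrite (DcharacE Uo xis family_zeta_smooth); last first.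
  by rewrite /= xu_family; exact: (BU Bxk).1.
rewrite -/q xuq uc_family11// uc_family20// => /eqP.
by rewrite -addrA -opprD subr_eq0 addrC => /eqP.
Qed.

(** Used in two directions: v = (0, 0, 1), the parameter, to exclude co-order 0, and v = (xi, 1, 0),
    whose image is that of the prolonged field, when the co-order is 1. *)
Lemma derive_along_family (W : set (R * R * R * R)) (Lt : R * R * R * R -> R)
    (B' : set (R * R * R)) z (v : R * R * R) :
  smooth_on W Lt -> open B' -> B' `<=` B -> B' z -> W (z.1, f z, f1 z) ->
  (forall z, B' z -> Lt (z.1, f z, f1 z) = 0) ->
  'D_((v.1, 'D_v f z, 'D_v f1 z) : R * R * R * R) Lt (z.1, f z, f1 z) = 0.
Proof.
move=> Lts B'o B'B B'z Wz Lt0.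
pose Psi (z : R * R * R) := (z.1, f z, f1 z).
have df : differentiable f z by apply: (fs 1%N).1; exact: B'B.
have df1 : differentiable f1 z by apply: (smooth_derive _ fs 1%N).1; exact: B'B.
have fstc : continuous (fst : R * R * R -> R * R) by move=> w; exact: cvg_fst.
have d1 : differentiable (fst : R * R * R -> R * R) z.
  exact: linear_differentiable.
have d1E : 'd (fst : R * R * R -> R * R) z v = v.1.
  exact: (congr1 (@^~ v) (diff_lin z fstc)).
have dp := differentiable_pair d1 df.
have dP : differentiable Psi z := differentiable_pair dp df1.
have dLt : differentiable Lt (Psi z) by apply: (Lts 1%N).1.
have PE : 'd Psi z v = (v.1, 'D_v f z, 'D_v f1 z).
  apply: etrans (congr1 (@^~ v) (diff_pair dp df1)) _.
  congr (_, _); last by rewrite deriveE.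
  apply: etrans (congr1 (@^~ v) (diff_pair d1 df)) _.
  by congr (_, _); [exact: d1E|rewrite deriveE].
have E0 : 'D_v (Lt \o Psi) z = 0.
  apply: etrans (near_eq_derive (g := cst 0) v (near_open B'o B'z Lt0)) _.
  exact: derive_cst.
apply: etrans (esym (_ : 'D_v (Lt \o Psi) z = _)) E0.
apply: etrans (deriveE _ (differentiable_comp dP dLt)) _.
apply: etrans (congr1 (@^~ v) (diff_comp dP dLt)) _.
exact: etrans (congr1 ('d Lt (Psi z)) PE) (esym (deriveE _ dLt)).
Qed.

End FamilyJets.

Theorem theorem7 (R : realType) (r : nat) (hr : (1 < r)%N)
  (Om : set (jet R r)) (hOm : open Om)
  (L : jet R r -> R) (hL : smooth_on Om L) (hLr : order_is Om L r%:Z)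
  (G : set (R * R * R)) (hG : open G) (hOmG : forall p, Om p -> G (xu p))
  (xi : R * R * R -> R) (hxi : smooth_on G xi)
  (hS : coorder_one_singular Om L (reduced_set G xi))
  (hrank : forall Q, reduced_set G xi Q -> max_rank Om L Q)
  (V : set (R * R * R)) (f : R * R * R -> R)
  (hF : solution_family Om L V f)
  (x0 : R * R) (kappa0 : R) (hV0 : V (x0, kappa0)) :
  exists (V' : set (R * R * R)) (Om' : set (jet R r))
         (U : set (R * R * R)) (zeta : R * R * R -> R),
    [/\ [/\ open V', V' `<=` V & V' (x0, kappa0)],
        [/\ open Om', Om' `<=` Om &
            forall x kappa, V' (x, kappa) ->
              Om' (jet_of r (fun y => f (y, kappa)) x)],
        [/\ open U, U `<=` G & smooth_on U zeta],
        forall x kappa, V' (x, kappa) ->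
          invariant_at (Qzeta xi U zeta) (fun y => f (y, kappa)) x &
        reduction_operator Om' L (Qzeta xi U zeta)].
Proof.
have [Vo fs f0 hsol] := hF; have r0 := ltnW hr.
have [B [U [Phi [[Bo BV Bz0] [Uo Phis] UBf BU]]]] := implicit_function Vo fs f0 hV0.
have UB z : U z -> B (z.1, Phi z) by move=> /UBf[].
have fsB : smooth_on B f by move=> n; exact: Cn_on_subset BV (fs n).
have jOm x k : B (x, k) -> Om (jet_of r (fun y => f (y, k)) x) /\
    L (jet_of r (fun y => f (y, k)) x) = 0 by move=> /BV; exact: hsol.
(* Every point of [U] lies on the graph of a member of the family, whose jet is in [Om]. *)
have UG : U `<=` G.
  move=> [x u] /UBf[/= Bz E]; have := hOmG _ (jOm _ _ Bz).1.
  by rewrite xu_family E.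
have xisU : smooth_on U xi by move=> n; exact: Cn_on_subset UG (hxi n).
pose zeta := family_zeta f Phi xi.
have zetas : smooth_on U zeta by exact: (family_zeta_smooth Bo Uo fsB xisU Phis UB).
pose Q := Qzeta xi U zeta.
have SQ : reduced_set G xi Q by exists U, zeta.
have Qj x k : B (x, k) -> Qman Q (jet_of r (fun y => f (y, k)) x).
  by move=> Bxk; exact: (Qman_family Bo Uo fsB xisU Phis UB BU r0 Bxk).
have inv x k : B (x, k) -> invariant_at Q (fun y => f (y, k)) x.
  move=> Bxk; split; first exact: (BU _ _ Bxk).1.
  exact: (charac_family xi BU Bxk).
have dL p : Om p -> differentiable L p by exact: (hL 1%N).1.
have [hS1 hS2 _] := hS.
have [m [cm _]] := hS1 Q SQ; have m1 := hS2 Q m SQ cm.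
pose f1 := 'D_((1, 0, 0) : R * R * R) f.
(* Nonnegative co-orders come first and -1 is left for the end; below -1 [order_le] is false. *)
case: m cm m1 => [n|[|n]] cm m1; last by case: cm.1.
  have n1 : (n <= 1)%N by [].
  have [W [Lt [el Lt0]]] := eliminated_of_order_le Uo xisU zetas r0 n1 cm.1.
  have [Wo Lts LLt] := el.
  have onF z : B z -> W (z.1, f z, f1 z) /\ Lt (z.1, f z, f1 z) = 0.
    case: z => x k Bz; have [Omj Lj] := jOm _ _ Bz.
    have [Wj E] := LLt _ Omj (Qj _ _ Bz).
    by rewrite -(xuu1_family f x k r0) -E.
  have [max0 max1] := hrank Q SQ W Lt el.
  have [Om0 L0] := jOm _ _ Bz0.
  have [W0 LtW0] := onF _ Bz0.
  have along z (v : R * R * R) : B z ->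
      'D_((v.1, 'D_v f z, 'D_v f1 z) : R * R * R * R) Lt (z.1, f z, f1 z) = 0.
    move=> Bz; have [Wz _] := onF z Bz.
    exact: (derive_along_family fsB v Lts Bo (fun _ h => h) Bz Wz
      (fun y By => (onF y By).2)).
  have dLt w : W w -> differentiable Lt w by exact: (Lts 1%N).1.
  case: n n1 cm m1 Lt0 => [|[|//]] _ cm _ Lt0.
    have := max0 cm _ Om0 (Qj _ _ Bz0).
    rewrite (xuu1_family f x0 kappa0 r0) -/f1 => /(_ LtW0).
    have := along (x0, kappa0) (0, 1) Bz0.
    set a := 'D_ _ f _; set b := 'D_ _ f1 _.
    have -> : ((0, 1) : R * R * R).1 = 0 by [].
    have -> : (0, a, b) = a *: (0, 0, 1, 0) + b *: (0, 0, 0, 1) :> R * R * R * R.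
      by rewrite !pairZ !pairD !scaler0 !add0r addr0 /GRing.scale /= !mulr1.
    rewrite deriveE; last exact: dLt.
    rewrite linearD !linearZ /= -!deriveE; [|exact: dLt..].
    (* This Lt is independent of u_1, so of the derivative in the parameter only f_kappa Lt_u
       remains, and neither factor vanishes. *)
    rewrite (Lt0 erefl) scaler0 addr0 => /eqP; rewrite mulf_eq0.
    by move=> /orP[/eqP a0|/eqP ->]; [have := f0 _ hV0; rewrite -/a a0 eqxx|rewrite eqxx].
  have slope : 'D_((0, 1) : (R * R * R) * R) Lt (x0, f (x0, kappa0), f1 (x0, kappa0)) != 0.
    have := max1 cm _ Om0 (Qj _ _ Bz0).
    by rewrite (xuu1_family f x0 kappa0 r0) -/f1 => /(_ LtW0).
  (* Here the base space is that of (x, u) and the last variable is u_1: in the ball of radius e, Lt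
     has at most one root u_1 over each (x, u). *)
  have [c [e [e0 eW mono]]] := slice_increasing Wo W0 dLt
    ((Lts 1%N).2 (0, 1) _ W0) slope.
  pose w0 : R * R * R * R := (x0, f (x0, kappa0), f1 (x0, kappa0)).
  pose V' : set (R * R * R) := [set z | B z /\ ball w0 e (z.1, f z, f1 z)].
  have V'o : open V'.
    rewrite openE => z [Bz bz]; apply: filterI; first exact: open_nbhs_nbhs.
    have fc := differentiable_continuous ((fsB 1%N).1 z Bz).
    have f1c : {for z, continuous f1} by apply: (fsB 1%N).2.
    have Pc : {for z, continuous (fun z : R * R * R => (z.1, f z, f1 z))}.
      exact: (cvg_pair (cvg_pair cvg_fst fc) f1c).
    by apply: Pc; apply: open_nbhs_nbhs; split; [exact: ball_open|exact: bz].
  pose U2 : set (R * R * R) := [set z | U z /\ V' (z.1, Phi z)].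
  have U2o : open U2.
    rewrite openE => z [Uz Vz]; apply: filterI; first exact: open_nbhs_nbhs.
    have Pc : {for z, continuous (fun z : R * R * R => (z.1, Phi z))}.
      exact: (cvg_pair cvg_fst (Phis 0%N z Uz)).
    by apply: Pc; apply: open_nbhs_nbhs.
  (* Two points over the same (x, u) have to lie in the ball: the one given by the jet p, by the
     last condition, and the one given by the family, through [U2]. *)
  pose Om' : set (jet R r) := [set p | Om p /\ (U2 (xu p) /\ ball w0 e (xuu1 p))].
  exists V', Om', U, zeta; split.
  - split=> //; first by move=> z [/BV].
    by split=> //; exact: ballxx.
  - split; [|by move=> p []|].
      rewrite openE => p [Omp [U2p bp]]; apply: filterI.
        by apply: open_nbhs_nbhs.
      apply: filterI.
        by apply: (@xu_continuous R r p); apply: open_nbhs_nbhs.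
      have xc := differentiable_continuous (differentiable_xuu1 p).1.
      by apply: xc; apply: open_nbhs_nbhs; split; [exact: ball_open|exact: bp].
    move=> x k [Bz bz]; split; first exact: (jOm _ _ Bz).1.
    rewrite xu_family (xuu1_family f x k r0); split; last exact: bz.
    by split; [exact: (BU _ _ Bz).1|rewrite /= (BU _ _ Bz).2].
  - by split.
  - by move=> x k [Bz _]; exact: inv.
  - move=> p [Omp [[Up V'p] bp]] Qp Lp.
    have Bz := V'p.1; set k := Phi (xu p) in V'p Bz.
    have fz : f ((xu p).1, k) = (xu p).2 := (UBf _ Up).2.
    have [Wz Ltz] := onF _ Bz.
    (* The values u_1 at p and f_1 of the family are both roots of Lt over the same (x, u) inside
       the ball, so strict monotonicity forces them to be equal. *)
    have pE : xuu1 p = ((xu p).1, f ((xu p).1, k), f1 ((xu p).1, k)).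
      have Lt1 : Lt (xu p, uc p 1 0) = 0 by rewrite -Lp (LLt p Omp Qp).2.
      have zE : ((xu p).1, f ((xu p).1, k)) = xu p by rewrite fz -surjective_pairing.
      have Lt2 : Lt (xu p, f1 ((xu p).1, k)) = 0 by rewrite -{1}zE.
      have [b1 b2] : ball w0 e (xu p, f1 ((xu p).1, k)) by rewrite -{1}zE; exact: V'p.2.
      have [_ b3] := bp.
      rewrite zE -[LHS]/(xu p, uc p 1 0); congr (_, _).
      have [lt|lt|//] := ltgtP (uc p 1 0) (f1 ((xu p).1, k)).
        by have := mono _ _ _ b1 b3 b2 lt; rewrite Lt1 Lt2 ltxx.
      by have := mono _ _ _ b1 b2 b3 lt; rewrite Lt1 Lt2 ltxx.
    rewrite (prolong_eliminated Uo xisU zetas r0 hOm Omp Qp (dL p Omp) el).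
    have [-> ->] := low_part_family Bo Uo fsB xisU Phis UB BU hr Bz pE.
    rewrite pE; exact: (along ((xu p).1, k) (xi (xu p), 1, 0) Bz).
(* Co-order -1: L vanishes on the manifold, the zero function is an eliminated one, and [Om] is kept
   whole. *)
exists B, Om, U, zeta; split => //.
  by split=> // x k /jOm[].
move=> p Omp Qp Lp.
have el : eliminated Om L Q setT (fun=> 0).
  split; [exact: openT|by move=> n; exact: Cn_on_cst|].
  by move=> q Omq Qq; split=> //; exact: (cm.1 q (conj Omq Qq)).
rewrite (prolong_eliminated Uo xisU zetas r0 hOm Omp Qp (dL p Omp) el).
exact: derive_cst.
Qed.
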